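(* Let $k\ge 0$, $1\le p<+\infty$ and $f\in L^p(\mathbb{R},|x|^{2k}dx)$. Then for all $t>0$ and $x\in\mathbb{R}$ the Poisson integral $F_k(f)(t,x)=\sum_{n=0}^{+\infty}e^{-t\sqrt{2n+2k+1}}a_n^k(f)h_n^k(x)$ has the integral representation $$F_k(f)(t,x)=\int_{\mathbb{R}}f(y)A_k(t,x,y)|y|^{2k}\,dy,$$ where $$A_k(t,x,y)=\frac{t}{\sqrt{4\pi}}\int_0^{+\infty}P_k(u,x,y)\,u^{-\frac32}e^{-\frac{t^2}{4u}}\,du,\qquad P_k(u,x,y)=\sum_{n=0}^{+\infty}e^{-u(2n+2k+1)}h_n^k(x)h_n^k(y).$$
   Context: Dunkl--Hermite functions: for $n\ge 0$, $h_n^k(x)=e^{-x^2/2}H_n^k(x)$, where $$H_{2n}^k(x)=(-1)^n\sqrt{\tfrac{n!}{\Gamma(n+k+\frac12)}}\,L_n^{k-\frac12}(x^2),\qquad H_{2n+1}^k(x)=(-1)^n\sqrt{\tfrac{n!}{\Gamma(n+k+\frac32)}}\,x\,L_n^{k+\frac12}(x^2),$$ and $L_n^\alpha(x)=\frac{1}{n!}x^{-\alpha}e^x\frac{d^n}{dx^n}(x^{n+\alpha}e^{-x})$ are the Laguerre polynomials. $L^p(\mathbb{R},|x|^{2k}dx)$ is the space of measurable $f$ on $\mathbb{R}$ with $\|f\|_{k,p}=\left(\int_{\mathbb{R}}|f(x)|^p|x|^{2k}dx\right)^{1/p}<+\infty$. The coefficients are $a_n^k(f)=\int_{\mathbb{R}}f(t)h_n^k(t)|t|^{2k}dt$.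 *)

(* Defs.v *)
From HB Require Import structures.
From mathcomp Require Import all_boot all_order all_algebra.
From mathcomp Require Import ring.
From mathcomp Require Import all_classical all_reals all_analysis.
Set Implicit Arguments.
Unset Strict Implicit.
Unset Printing Implicit Defensive.
Import Order.TTheory GRing.Theory Num.Theory.
Import numFieldNormedType.Exports.
Local Open Scope classical_set_scope.
Local Open Scope ring_scope.

Definition Gamma {R : realType} (s : R) : R :=
  \int[lebesgue_measure]_(x in `]0%R, +oo[) (x `^ (s - 1) * expR (- x)).

Definition laguerre_rodrigues {R : realType} (a : R) (n : nat) (x : R) : R :=
  (n`!%:R)^-1 * x `^ (- a) * expR x *
  derive1n n (fun y : R => y `^ (n%:R + a) * expR (- y)) x.

(* Rodrigues' formula only makes sense for x > 0, while the Laguerre polynomials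
   are also evaluated at 0; hence the polynomial that agrees with the formula on
   ]0, +oo[ (it is unique, and exists by [laguerreE]). *)
Definition laguerre {R : realType} (a : R) (n : nat) : {poly R} :=
  xget 0 [set q : {poly R} |
    forall x : R, 0 < x -> q.[x] = laguerre_rodrigues a n x].

Lemma laguerre_derive1n {R : realType} (b : R) (j : nat) :
  exists q : {poly R}, forall x : R, 0 < x ->
    derive1n j (fun y : R => y `^ b * expR (- y)) x =
    x `^ (b - j%:R) * expR (- x) * q.[x].
Proof.
elim: j => [|j [q IH]].
  by exists 1 => x x0; rewrite hornerC mulr1 subr0.
exists (((b - j%:R)%:P - 'X) * q + 'X * q^`()) => x x0.
rewrite derive1nS derive1E.
set c := b - j%:R.
rewrite (@near_eq_derive _ _ _ _ (fun y : R => y `^ c * expR (- y) * q.[y]));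
  last first.
  by near=> y; apply: IH; near: y; exact: lt_nbhsr.
have Hp := @is_derive1_powR R c x x0.
have He : is_derive x 1 (fun y : R => expR (- y)) (- expR (- x)).
  have H := @is_derive1_comp R expR (@GRing.opp R) x _ _
    (is_derive_expR (- x)) (is_deriveNid x 1).
  by apply: is_derive_eq; rewrite mulrN1.
have Hq : is_derive x 1 (fun y : R => q.[y]) q^`().[x] := is_derive_poly q x.
have H := is_deriveM (is_deriveM Hp He) Hq.
have -> : b - j.+1%:R = c - 1 by rewrite /c -natr1 opprD addrA.
have -> : 'D_1 (fun y : R => y `^ c * expR (- y) * q.[y]) x = _ :=
  @derive_val _ _ _ _ _ _ _ H.
have Ec : x `^ c = x * x `^ (c - 1).
  by rewrite -[X in X * _](powRr1 (ltW x0)) -powRD ?(gt_eqF x0)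
    ?implybT// addrC subrK.
change (x `^ c * expR (- x) * q^`().[x] + q.[x] *
  (x `^ c * - expR (- x) + expR (- x) * (c * x `^ (c - 1))) =
  x `^ (c - 1) * expR (- x) * ((c%:P - 'X) * q + 'X * q^`()).[x]).
by rewrite !(hornerD, hornerM, hornerN, hornerC, hornerX) Ec; ring.
Unshelve. all: by end_near. Qed.

Lemma laguerreE {R : realType} (a : R) (n : nat) (x : R) :
  0 < x -> (laguerre a n).[x] = laguerre_rodrigues a n x.
Proof.
rewrite /laguerre; case: xgetP => [q _ /(_ x)//|/= noq _].
have [q Hq] := laguerre_derive1n (n%:R + a) n; exfalso.
apply: (noq ((n`!%:R)^-1 *: q)) => y y0.
rewrite /laguerre_rodrigues Hq // hornerZ addrAC subrr add0r.
have Ha : y `^ (- a) * y `^ a = 1.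
  by rewrite -powRD ?(gt_eqF y0) ?implybT// addNr powRr0.
have He : expR y * expR (- y) = 1 by rewrite expRxMexpNx_1.
rewrite -[LHS]mulr1 -[X in _ * X]mulr1
  -[X in _ * (X * _)]Ha -[X in _ * (_ * X)]He.
by ring.
Qed.

Section dunkl_hermite.
Context {R : realType}.
Implicit Types (k p t u x y : R) (n : nat) (f : R -> R).

Definition dunkl_H k n x : R :=
  let m := n./2 in
  if odd n then
    (-1) ^+ m * Num.sqrt (m`!%:R / Gamma (m%:R + k + 3 / 2)) *
      x * (laguerre (k + 1 / 2) m).[x ^+ 2]
  else
    (-1) ^+ m * Num.sqrt (m`!%:R / Gamma (m%:R + k + 1 / 2)) *
      (laguerre (k - 1 / 2) m).[x ^+ 2].

Definition dunkl_h k n x : R := expR (- (x ^+ 2 / 2)) * dunkl_H k n x.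

Definition dunkl_weight k x : R := `|x| `^ (2 * k).

Definition dunkl_Lp k p f : Prop :=
  measurable_fun setT f /\
  (\int[lebesgue_measure]_x (`|f x| `^ p * dunkl_weight k x)%:E < +oo)%E.

Definition dunkl_coef k f n : R :=
  \int[lebesgue_measure]_s (f s * dunkl_h k n s * dunkl_weight k s).

Definition poisson_term k f t x n : R :=
  expR (- t * Num.sqrt (2 * n%:R + 2 * k + 1)) * dunkl_coef k f n *
  dunkl_h k n x.

Definition poisson_integral k f t x : R := limn (series (poisson_term k f t x)).

Definition mehler_term k u x y n : R :=
  expR (- u * (2 * n%:R + 2 * k + 1)) * dunkl_h k n x * dunkl_h k n y.

Definition mehler_kernel k u x y : R := limn (series (mehler_term k u x y)).

Definition subordination_integrand k t x y u : R :=
  mehler_kernel k u x y * u `^ (- (3 / 2)) * expR (- (t ^+ 2 / (4 * u))).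

Definition poisson_kernel k t x y : R :=
  t / Num.sqrt (4 * pi) *
  \int[lebesgue_measure]_(u in `]0%R, +oo[) subordination_integrand k t x y u.

End dunkl_hermite.

(* Main.v *)
Require Import Defs.
From HB Require Import structures.
From mathcomp Require Import all_boot all_order all_algebra.
From mathcomp Require Import ring lra.
From mathcomp Require Import all_classical all_reals all_analysis.
From mathcomp Require Import measurable_realfun.
Import Order.TTheory GRing.Theory Num.Theory.
Import numFieldNormedType.Exports.

(** Write $\lambda_n = \sqrt{2n + 2k + 1}$. Subordination is the identity
    $$e^{-t\lambda} = \frac{t}{\sqrt{4\pi}} \int_0^\infty
        u^{-3/2} e^{-t^2/(4u)} e^{-u\lambda^2}\,du$$
    ([integral_subordinator]). Integrating the series of $P_k(u,x,y)$ term by term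
    against $u^{-3/2} e^{-t^2/(4u)}$ gives
    $A_k(t,x,y) = \sum_n e^{-t\lambda_n} h_n^k(x) h_n^k(y)$
    ([poisson_kernel_series]), and integrating this series term by term against
    $f(y) |y|^{2k}$ gives $F_k(f)(t,x)$. Both exchanges are instances of
    [integral_series], which asks for a convergent series of bounds on the
    integrals of the absolute values.

    Since $e^{-t\lambda_n}$ decreases faster than every power of $n$
    ([is_cvg_series_expR_sqrt]), it is enough that, for fixed $x$, $|h_n^k(x)|$
    and $\int |f(y)| |h_n^k(y)| |y|^{2k}\,dy$ grow at most like powers of $n$. As
    $|f| \le 1 + |f|^p$, this follows from a pointwise bound
    $(1+y^2)^N |h_n^k(y)| \le C (n+1)^M$ for every $N$ ([dunkl_h_growth]).

    The pointwise bound comes from the differential equation of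
    $e^{-z/2} L_n^a(z)$ with $a \ge -1/2$. The energy attached to it is
    nonincreasing on the half-line, which bounds this function by its value at $0$
    times a factor of order $n$ ([sonin_bound]); the three-term recurrence then
    trades powers of $z$ for powers of $n$ ([laguerre_fun_growth]), and Euler's
    integral restricted to $[m+1, m+2]$ bounds the normalization
    ([Gamma_growth]). *)

Set Implicit Arguments.
Unset Strict Implicit.
Unset Printing Implicit Defensive.
Local Open Scope classical_set_scope.
Local Open Scope ring_scope.

(** * Laguerre polynomials by their coefficients *)

Section laguerre_algebra.
Context {R : realType}.
Implicit Types (a x : R) (n j : nat).

(** This is $(-1)^j \binom{n+a}{n-j} / j!$ with the binomial coefficient of real
    upper argument expanded as a product. The factor ['C(n, j)] makes it vanish
    for [n < j], so that identities between coefficients hold for every [j], and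
    for every real [a]. *)
Definition laguerre_coef a n j : R :=
  (-1) ^+ j * 'C(n, j)%:R / n`!%:R * \prod_(j <= m < n) (a + 1 + m%:R).

Definition laguerre_poly a n : {poly R} := \poly_(j < n.+1) laguerre_coef a n j.

Lemma coef_laguerre_poly a n j : (laguerre_poly a n)`_j = laguerre_coef a n j.
Proof.
rewrite coef_poly; case: ltnP => // nj.
by rewrite /laguerre_coef bin_small// mulr0 !mul0r.
Qed.

Lemma natf_neq0 n : n.+1%:R != 0 :> R. Proof. by rewrite pnatr_eq0. Qed.
Lemma factf_neq0 n : n`!%:R != 0 :> R.
Proof. by rewrite pnatr_eq0 -lt0n fact_gt0. Qed.

Lemma laguerre_coef_ode a n j :
  j.+1%:R * (a + 1 + j%:R) * laguerre_coef a n j.+1 = (j%:R - n%:R) * laguerre_coef a n j.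
Proof.
rewrite /laguerre_coef exprS; have [nj|jn] := leqP n j.
  rewrite (@bin_small n j.+1)// mulr0 !mul0r mulr0.
  have [->|nj'] := eqVneq n j; first by rewrite subrr mul0r.
  by rewrite bin_small ?mulr0 ?mul0r ?mulr0// ltn_neqAle nj'.
rewrite [in RHS]big_ltn//.
have := mul_bin_left n j => /(congr1 (fun m => m%:R : R)).
rewrite !natrM (natrB _ (ltnW jn)) => H.
set P := \prod_(_ <= _ < _) _.
have -> : j.+1%:R * (a + 1 + j%:R) * (-1 * (-1) ^+ j * 'C(n, j.+1)%:R / n`!%:R * P)
  = - (j.+1%:R * 'C(n, j.+1)%:R) * (a + 1 + j%:R) * (-1) ^+ j / n`!%:R * P by ring.
by rewrite H; ring.
Qed.

Lemma laguerre_coef_rodrigues a n j :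
  n.+1%:R * laguerre_coef a n.+1 j = (a + 1 + j%:R) * laguerre_coef (a + 1) n j -
    (if j is j'.+1 then laguerre_coef (a + 1) n j' else 0).
Proof.
rewrite /laguerre_coef factS natrM.
have F : n.+1%:R / (n.+1%:R * n`!%:R) = (n`!%:R)^-1 :> R.
  by rewrite invfM mulrA divff ?natf_neq0// mul1r.
set P := \prod_(j <= m < n.+1) _.
have -> : n.+1%:R * ((-1) ^+ j * 'C(n.+1, j)%:R / (n.+1%:R * n`!%:R) * P)
   = (-1) ^+ j * 'C(n.+1, j)%:R * (n.+1%:R / (n.+1%:R * n`!%:R)) * P by ring.
rewrite F {F}.
have shift i : \prod_(i <= m < n) (a + 1 + 1 + m%:R) =
    \prod_(i.+1 <= m < n.+1) (a + 1 + m%:R).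
  by rewrite [RHS]big_add1; apply: eq_bigr => m _; rewrite -addn1 natrD; ring.
rewrite /P !shift {P}.
case: j => [|j].
  rewrite !bin0 expr0 big_ltn// !mul1r subr0; ring.
rewrite shift binS natrD.
have [jn|] := ltnP j n.
  by rewrite big_ltn ?ltnS// exprS; ring.
rewrite leq_eqVlt => /orP[/eqP <-|nj].
  by rewrite !binn !bin_small// exprS; ring.
by rewrite !bin_small ?(leq_trans nj)//; ring.
Qed.

(** The $n$-th derivative of $y^{n+1+a} e^{-y}$ is
    $n!\, y^{a+1} e^{-y} L_n^{a+1}(y)$. Differentiating it once more gives the next
    derivative, which is the recursion that Rodrigues' formula imposes. *)
Lemma laguerre_poly_rodrigues a n : n.+1%:R *: laguerre_poly a n.+1 =
  ((a + 1)%:P - 'X) * laguerre_poly (a + 1) n + 'X * (laguerre_poly (a + 1) n)^`().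
Proof.
apply/polyP => j; rewrite coefZ mulrBl !(coefB, coefD) coefCM !coefXM.
rewrite !coef_laguerre_poly laguerre_coef_rodrigues; case: j => [|j] /=.
  by rewrite !addr0.
by rewrite coef_deriv !coef_laguerre_poly -mulr_natl; ring.
Qed.

Lemma laguerre_poly_ode a n : 'X * (laguerre_poly a n)^`()^`() +
  ((a + 1)%:P - 'X) * (laguerre_poly a n)^`() + n%:R *: laguerre_poly a n = 0.
Proof.
apply/polyP => j; rewrite coef0 !(coefD, coefZ) mulrBl coefB coefCM !coefXM.
case: j => [|j] /=.
  rewrite !add0r !subr0 coef_deriv !coef_laguerre_poly.
  have := laguerre_coef_ode a n 0; rewrite !sub0r addr0 -mulr_natl => E.
  apply/eqP; rewrite addr_eq0; apply/eqP.
  by rewrite -mulNr -E; ring.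
rewrite !coef_deriv !coef_laguerre_poly.
have E := laguerre_coef_ode a n j.+1.
rewrite -[_ *+ j.+2 *+ _]mulr_natl -[laguerre_coef a n j.+2 *+ _]mulr_natl.
rewrite -[laguerre_coef a n j.+1 *+ _]mulr_natl.
have -> : n%:R * laguerre_coef a n j.+1 = j.+1%:R * laguerre_coef a n j.+1 -
    (j.+1%:R - n%:R) * laguerre_coef a n j.+1 by ring.
by rewrite -E -!natr1; ring.
Qed.

Lemma laguerre_poly_three_term a n :
  'X * laguerre_poly a n.+1 = (2 * n.+1%:R + a + 1) *: laguerre_poly a n.+1
    - n.+2%:R *: laguerre_poly a n.+2 - (n.+1%:R + a) *: laguerre_poly a n.
Proof.
apply/polyP => j; rewrite coefXM !(coefB, coefZ) !coef_laguerre_poly.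
apply: (mulfI (factf_neq0 n.+1)).
have f1 i : (n.+1)`!%:R * laguerre_coef a n.+1 i =
    (-1) ^+ i * 'C(n.+1, i)%:R * \prod_(i <= m < n.+1) (a + 1 + m%:R).
  by rewrite /laguerre_coef; field; rewrite factf_neq0.
have f0 : (n.+1)`!%:R * laguerre_coef a n j =
    n.+1%:R * ((-1) ^+ j * 'C(n, j)%:R * \prod_(j <= m < n) (a + 1 + m%:R)).
  by rewrite /laguerre_coef factS natrM; field; rewrite factf_neq0.
have f2 : n.+2%:R * ((n.+1)`!%:R * laguerre_coef a n.+2 j) =
    (-1) ^+ j * 'C(n.+2, j)%:R * \prod_(j <= m < n.+2) (a + 1 + m%:R).
  rewrite /laguerre_coef (factS n.+1) natrM invfM.
  by field; rewrite factf_neq0 -natrD pnatr_eq0.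
have -> : (n.+1)`!%:R * ((2 * n.+1%:R + a + 1) * laguerre_coef a n.+1 j
      - n.+2%:R * laguerre_coef a n.+2 j - (n.+1%:R + a) * laguerre_coef a n j)
  = (2 * n.+1%:R + a + 1) * ((n.+1)`!%:R * laguerre_coef a n.+1 j)
    - n.+2%:R * ((n.+1)`!%:R * laguerre_coef a n.+2 j)
    - (n.+1%:R + a) * ((n.+1)`!%:R * laguerre_coef a n j) by ring.
rewrite f0 f1 f2 {f0 f2}.
case: j => [|i] /=.
  rewrite mulr0 !bin0 !expr0 !big_nat_recr//= -!natr1; ring.
rewrite f1 {f1}.
have [iN|] := ltnP i.+1 n.+1.
  have B1 : n.+1%:R * 'C(n, i.+1)%:R = (n.+1%:R - i.+1%:R) * 'C(n.+1, i.+1)%:R :> R.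
    by have := mul_bin_down n.+1 i.+1 => /(congr1 (fun m => m%:R : R));
      rewrite !natrM (natrB _ (ltnW iN)).
  have B2 : i.+1%:R * 'C(n.+1, i.+1)%:R = (n.+1%:R - i%:R) * 'C(n.+1, i)%:R :> R.
    by have := mul_bin_left n.+1 i => /(congr1 (fun m => m%:R : R));
      rewrite !natrM (natrB _ (ltnW (ltnW iN))).
  have -> : \prod_(i <= m < n.+1) (a + 1 + m%:R) =
      (a + 1 + i%:R) * \prod_(i.+1 <= m < n.+1) (a + 1 + m%:R).
    by rewrite big_ltn// (ltn_trans _ iN).
  have -> : \prod_(i.+1 <= m < n.+2) (a + 1 + m%:R) =
      (\prod_(i.+1 <= m < n.+1) (a + 1 + m%:R)) * (a + 1 + n.+1%:R).
    by rewrite big_nat_recr//= ltnW.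
  have QP : (n.+1%:R + a) * \prod_(i.+1 <= m < n) (a + 1 + m%:R) =
      \prod_(i.+1 <= m < n.+1) (a + 1 + m%:R).
    by rewrite big_nat_recr//= mulrC -natr1; congr (_ * _); ring.
  have -> : (n.+1%:R + a) *
     (n.+1%:R * ((-1) ^+ i.+1 * 'C(n, i.+1)%:R * \prod_(i.+1 <= m < n) (a + 1 + m%:R)))
    = (-1) ^+ i.+1 * (n.+1%:R * 'C(n, i.+1)%:R) * ((n.+1%:R + a) *
        \prod_(i.+1 <= m < n) (a + 1 + m%:R)) by ring.
  rewrite QP B1 (binS n.+1) natrD; set P := \prod_(_ <= m < _) _.
  rewrite exprS; set e := (-1) ^+ i; apply/eqP; rewrite -subr_eq0; apply/eqP.
  transitivity (e * P * (i.+1%:R * 'C(n.+1, i.+1)%:R - (n.+1%:R - i%:R) * 'C(n.+1, i)%:R)).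
    by rewrite -!natr1; ring.
  by rewrite B2; ring.
rewrite leq_eqVlt => /orP[/eqP[<-]|].
  rewrite !binSn binn bin_small// !big_nat1 (@big_geq _ _ _ n.+1 n.+1)//.
  by rewrite exprS -!natr1; ring.
rewrite ltnS leq_eqVlt => /orP[/eqP<-|ni].
  by rewrite !binn !(@bin_small _ n.+2)// !(mulr0, mul0r) !big_geq// !exprS; ring.
have n1i := ltnW ni; have n0i := ltnW n1i.
by rewrite !bin_small ?ltnS ?(ltnW n0i)// !(mulr0, mul0r) !subr0.
Qed.

Lemma laguerre_poly0 a n : (laguerre_poly a n).[0] = \prod_(m < n) ((a + m.+1%:R) / m.+1%:R).
Proof.
rewrite horner_coef0 coef_laguerre_poly /laguerre_coef expr0 bin0 !mul1r big_mkord.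
rewrite prodf_div mulrC; congr (_ * _).
  by apply: eq_bigr => m _; rewrite -addrA nat1r.
by rewrite fact_prod natr_prod big_add1 big_mkord.
Qed.

Lemma laguerre_poly_derive1n b j x : 0 < x ->
  derive1n j (fun y : R => y `^ b * expR (- y)) x =
  j`!%:R * (x `^ (b - j%:R) * expR (- x) * (laguerre_poly (b - j%:R) j).[x]).
Proof.
elim: j x => [|j IH] x x0.
  rewrite subr0 fact0 mul1r /= /laguerre_poly poly_def big_ord_recl big_ord0.
  rewrite addr0 /laguerre_coef.
  by rewrite big_geq// expr0 bin0 fact0 divr1 !mulr1 expr0 scale1r hornerC mulr1.
rewrite derive1nS derive1E.
set c := b - j%:R.
rewrite (@near_eq_derive _ _ _ _
    (fun y : R => j`!%:R * (y `^ c * expR (- y) * (laguerre_poly c j).[y]))); last first.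
  by near=> y; apply: IH; near: y; exact: lt_nbhsr.
have Hp := @is_derive1_powR R c x x0.
have He : is_derive x 1 (fun y : R => expR (- y)) (- expR (- x)).
  have H := @is_derive1_comp R expR (@GRing.opp R) x _ _
    (is_derive_expR (- x)) (is_deriveNid x 1).
  by apply: is_derive_eq; rewrite mulrN1.
have Hq : is_derive x 1 (fun y : R => (laguerre_poly c j).[y]) _ :=
  is_derive_poly (laguerre_poly c j) x.
have H := is_deriveZ (j`!%:R) (is_deriveM (is_deriveM Hp He) Hq).
have -> : 'D_1 (fun y : R => j`!%:R * (y `^ c * expR (- y) * (laguerre_poly c j).[y])) x = _ :=
  @derive_val _ _ _ _ _ _ _ H.
have cE : b - j.+1%:R = c - 1 by rewrite /c -natr1 opprD addrA.
rewrite cE.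
have Ec : x `^ c = x * x `^ (c - 1).
  by rewrite -[X in X * _](powRr1 (ltW x0)) -powRD ?(gt_eqF x0)
    ?implybT// addrC subrK.
have := laguerre_poly_rodrigues (c - 1) j; rewrite subrK.
move=> /(congr1 (fun p : {poly R} => p.[x])).
rewrite hornerZ !(hornerD, hornerM, hornerN, hornerC, hornerX) => E.
rewrite factS natrM.
have -> : j.+1%:R * j`!%:R * (x `^ (c - 1) * expR (- x) * (laguerre_poly (c - 1) j.+1).[x]) =
  j`!%:R * (x `^ (c - 1) * expR (- x) * (j.+1%:R * (laguerre_poly (c - 1) j.+1).[x])) by ring.
rewrite E.
change (j`!%:R * (x `^ c * expR (- x) * (laguerre_poly c j)^`().[x] + (laguerre_poly c j).[x] *
  (x `^ c * - expR (- x) + expR (- x) * (c * x `^ (c - 1)))) =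
  j`!%:R * (x `^ (c - 1) * expR (- x) *
    ((c - x) * (laguerre_poly c j).[x] + x * (laguerre_poly c j)^`().[x]))).
by rewrite Ec; ring.
Unshelve. all: by end_near. Qed.

Lemma polyP_gt0 (p q : {poly R}) : (forall x, 0 < x -> p.[x] = q.[x]) -> p = q.
Proof.
move=> pq; apply/eqP; rewrite -subr_eq0; apply/negP => /negP nz.
have := @max_poly_roots _ (p - q) [seq (i.+1%:R : R) | i <- iota 0 (size (p - q))] nz.
rewrite size_map size_iota ltnn => H; apply: (notF (H _ _)).
  by apply/allP => _ /mapP[i _ ->]; rewrite /root hornerD hornerN pq ?subrr// ltr0Sn.
rewrite map_inj_uniq ?iota_uniq// => i i' /eqP.
by rewrite eqr_nat => /eqP[].
Qed.

(** Both sides agree with Rodrigues' formula on the half-line, which determines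
    a polynomial. *)
Lemma laguerre_polyE a n : laguerre a n = laguerre_poly a n.
Proof.
apply: polyP_gt0 => x x0; rewrite laguerreE// /laguerre_rodrigues laguerre_poly_derive1n//.
have -> : n%:R + a - n%:R = a by ring.
have Ha : x `^ (- a) * x `^ a = 1.
  by rewrite -powRD ?(gt_eqF x0) ?implybT// addNr powRr0.
have He : expR x * expR (- x) = 1 by rewrite expRxMexpNx_1.
transitivity ((n`!%:R^-1 * n`!%:R) * (x `^ (- a) * x `^ a)
  * (expR x * expR (- x)) * (laguerre_poly a n).[x]); first by ring.
by rewrite Ha He mulVf ?factf_neq0// !mul1r.
Qed.

End laguerre_algebra.

(** * Sonin's bound for Laguerre functions *)

Lemma ler_is_derive {R : realType} (f df : R -> R) (x y : R) : x <= y ->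
  (forall z, x <= z <= y -> is_derive z 1 f (df z)) ->
  (forall z, x <= z <= y -> 0 <= df z) -> f x <= f y.
Proof.
move=> xy fdf df0; rewrite -subr_ge0.
have cf : {within `[x, y], continuous f}.
  apply: derivable_within_continuous => z; rewrite in_itv/= => xzy.
  by case: (fdf _ xzy).
have fdf' z : z \in `]x, y[ -> is_derive z 1 f (df z).
  by rewrite in_itv/= => /andP[xz zy]; apply: fdf; rewrite !ltW.
have [z + ->] := MVT_segment xy fdf' cf.
by rewrite in_itv/= => xzy; rewrite mulr_ge0 ?df0// subr_ge0.
Qed.

Section sonin.
Context {R : realType}.
(** The function $v(z) = e^{-z/2} L_n^a(z)$ solves [ode] with $b = a + 1$ and
    $K = n + b/2$. The half-line splits at $2K$ and at the turning point $4K$: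
    the decreasing energy [E] controls [v] on the first part and its derivative
    on the second one, and past the turning point [v] cannot move away from $0$
    without failing to decay. *)
Variables (v dv ddv : R -> R) (b K : R).
Hypotheses (b_ge : 1 / 2 <= b) (K_gt0 : 0 < K).
Hypothesis vdv : forall z : R, is_derive z 1 v (dv z).
Hypothesis dvddv : forall z : R, is_derive z 1 dv (ddv z).
Hypothesis ode : forall z, z * ddv z + b * dv z + (K - z / 4) * v z = 0.
Hypothesis v_y : v z @[z --> +oo] --> 0.

Let E z := z * dv z ^+ 2 + (K - z / 4) * v z ^+ 2.

(** By [ode] the derivative of the energy is $-(2b - 1) v'^2 - v^2/4$, and this is
    where $b \geq 1/2$ enters, that is $k \geq 0$ for the Dunkl weight. *)
Let E_le (z : R) : 0 <= z -> E z <= E 0.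
Proof.
move=> z0; rewrite -lerN2.
pose dE z := (2 * b - 1) * dv z ^+ 2 + v z ^+ 2 / 4.
apply: (@ler_is_derive _ (fun z => - E z) dE) => //.
- move=> y _; rewrite /E; apply: is_derive_eq.
  transitivity (dE y - 2 * dv y * (y * ddv y + b * dv y + (K - y / 4) * v y)).
    by rewrite /GRing.scale /= /dE; field.
  by rewrite ode mulr0 subr0.
- move=> y _; rewrite /dE addr_ge0 ?divr_ge0 ?(mulr_ge0 _ (sqr_ge0 _)) ?sqr_ge0//.
  by have := b_ge; lra.
Qed.

Let derive_sqr (z : R) : is_derive z 1 (fun z => v z ^+ 2) (2 * (v z * dv z)).
Proof. by apply: is_derive_eq; rewrite /GRing.scale /=; ring. Qed.

Let head_le (z : R) : 0 <= z <= 2 * K -> `|v z| <= 2 * `|v 0|.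
Proof.
have K0 := K_gt0.
move=> /andP[z0 zK]; have := E_le z0; rewrite /E mul0r add0r mul0r subr0 => EK.
rewrite -ler_sqr ?nnegrE ?mulr_ge0// exprMn -!normrX.
rewrite !ger0_norm ?sqr_ge0//.
have K2 : K / 2 * v z ^+ 2 <= (K - z / 4) * v z ^+ 2.
  by rewrite ler_wpM2r ?sqr_ge0//; lra.
have dz : 0 <= z * dv z ^+ 2 by rewrite mulr_ge0 ?sqr_ge0.
have : K / 2 * v z ^+ 2 <= K * v 0 ^+ 2 by lra.
rewrite -mulrA ler_pM2l// => H.
have := sqr_ge0 (v 0); lra.
Qed.

Let middle_le (z : R) : 2 * K <= z <= 4 * K -> `|v z| <= (2 + 2 * K) * `|v 0|.
Proof.
have K0 := K_gt0.
move=> /andP[Kz zK].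
have dv_le y : 2 * K <= y <= 4 * K -> `|dv y| <= `|v 0|.
  move=> /andP[Ky yK]; have y0 : 0 <= y by rewrite (le_trans _ Ky)// mulr_ge0// ltW.
  have := E_le y0; rewrite /E mul0r add0r mul0r subr0 => EK.
  rewrite -ler_sqr ?nnegrE// -!normrX !ger0_norm ?sqr_ge0//.
  rewrite -(@ler_pM2l _ K)//.
  have : (2 * K) * dv y ^+ 2 <= y * dv y ^+ 2 by rewrite ler_wpM2r ?sqr_ge0.
  have : 0 <= (K - y / 4) * v y ^+ 2 by rewrite mulr_ge0 ?sqr_ge0//; lra.
  have : 0 <= K * dv y ^+ 2 by rewrite mulr_ge0 ?sqr_ge0// ltW.
  lra.
have cv : {within `[2 * K, z], continuous v}.
  by apply: derivable_within_continuous => y _; case: (vdv y).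
have [y + vE] := MVT_segment Kz (fun y _ => vdv y) cv.
rewrite in_itv/= => /andP[Ky yz].
have -> : v z = v (2 * K) + dv y * (z - 2 * K) by rewrite -vE addrC subrK.
rewrite (le_trans (ler_normD _ _))// [leRHS]mulrDl lerD//.
  by apply: head_le; rewrite lexx mulr_ge0// ltW.
rewrite normrM mulrC ler_pM//; last by rewrite dv_le// Ky (le_trans yz).
rewrite ger0_norm; lra.
Qed.

(** If $|v|$ were larger at $z$ than at the turning point, $v v'$ would be
    positive somewhere between. As $z^b v v'$ is nondecreasing past the turning
    point, $v^2$ would increase from then on, against $v \to 0$. *)
Let tail_le (z : R) : 4 * K <= z -> `|v z| <= `|v (4 * K)|.
Proof.
have K0 := K_gt0.
move=> Kz; rewrite leNgt; apply/negP => vKz.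
have K4 : 0 < 4 * K by rewrite mulr_gt0.
have cv : {within `[4 * K, z], continuous (fun z => v z ^+ 2)}.
  by apply: derivable_within_continuous => y _; case: (derive_sqr y).
have [x xz vE] := MVT_segment Kz (fun y _ => derive_sqr y) cv.
have {xz}Kx : 4 * K <= x by move: xz; rewrite in_itv/= => /andP[].
have vdvx : 0 < v x * dv x.
  have : 0 < v z ^+ 2 - v (4 * K) ^+ 2.
    rewrite subr_gt0 -(real_normK (num_real (v z))).
    by rewrite -(real_normK (num_real (v (4 * K)))) ltr_sqr ?nnegrE.
  rewrite vE => /lt_le_trans H; rewrite ltNge; apply/negP => le0.
  have /H : 2 * (v x * dv x) * (z - 4 * K) <= 0.
    by rewrite mulr_le0_ge0 ?subr_ge0// mulr_ge0_le0.
  by rewrite ltxx.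
have vdv_gt0 y : x <= y -> 0 < v y * dv y.
  move=> xy; have x0 : 0 < x := lt_le_trans K4 Kx.
  have y0 := lt_le_trans x0 xy.
  rewrite -(pmulr_rgt0 _ (powR_gt0 b y0)).
  apply: lt_le_trans (mulr_gt0 (powR_gt0 b x0) vdvx) _.
  pose dphi w := w `^ (b - 1) * (w * dv w ^+ 2 + (w / 4 - K) * v w ^+ 2).
  apply: (@ler_is_derive _ (fun w => w `^ b * (v w * dv w)) dphi) => //.
    move=> w /andP[xw _]; have w0 := lt_le_trans x0 xw.
    have Hp := @is_derive1_powR R b w w0.
    apply: is_derive_eq.
    have Ew : w `^ b = w * w `^ (b - 1).
      by rewrite -[X in X * _](powRr1 (ltW w0)) -powRD ?(gt_eqF w0)
        ?implybT// addrC subrK.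
    transitivity (dphi w + w `^ (b - 1) * v w *
        (w * ddv w + b * dv w + (K - w / 4) * v w)).
      by rewrite /GRing.scale /= /dphi Ew; ring.
    by rewrite ode mulr0 addr0.
  move=> w /andP[xw _]; have w0 := lt_le_trans x0 xw.
  rewrite /dphi mulr_ge0 ?powR_ge0// addr_ge0// mulr_ge0 ?sqr_ge0 ?(ltW w0)//.
  by have := le_trans Kx xw; lra.
have vx0 : 0 < v x ^+ 2.
  rewrite lt_def sqr_ge0 andbT sqrf_eq0; apply: contraTneq vdvx => ->.
  by rewrite mul0r ltxx.
have vx_le y : x <= y -> v x ^+ 2 <= v y ^+ 2.
  move=> xy; apply: (ler_is_derive xy (fun y _ => derive_sqr y)) => w /andP[xw _].
  by rewrite mulr_ge0// ltW// vdv_gt0.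
have : v y ^+ 2 @[y --> +oo] --> (0 : R) * 0 by apply: cvgM.
rewrite mulr0 => /cvgrPdist_lt/(_ _ vx0) [M [_ HM]].
have /HM : M < Num.max (M + 1) x by rewrite lt_max ltrDl ltr01.
rewrite sub0r normrN ger0_norm ?sqr_ge0//.
by rewrite ltNge vx_le// le_max lexx orbT.
Qed.

Lemma sonin_bound (z : R) : 0 <= z -> `|v z| <= (2 + 2 * K) * `|v 0|.
Proof.
move=> z0; have [zK|/ltW zK] := leP z (2 * K).
  by rewrite (le_trans (head_le _)) ?z0// ler_wpM2r// lerDl mulr_ge0 ?ltW.
have [zK'|/ltW zK'] := leP z (4 * K); first by rewrite middle_le ?zK.
rewrite (le_trans (tail_le zK'))// middle_le// lexx andbT.
by rewrite ler_wpM2r ?ltW// ltr_nat.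
Qed.

End sonin.

Section laguerre_bound.
Context {R : realType}.
Implicit Types (a z : R) (n : nat).

(** Each monomial is beaten by one term of higher degree of the exponential
    series, which leaves a multiple of $1/z$. *)
Lemma cvg_poly_expRN (p : {poly R}) : expR (- (z / 2)) * p.[z] @[z --> +oo] --> (0 : R).
Proof.
have mono i : expR (- (z / 2)) * z ^+ i @[z --> +oo] --> (0 : R).
  pose C : R := 2 ^+ i.+1 * i.+1`!%:R.
  have C0 : 0 <= C by rewrite mulr_ge0 ?exprn_ge0.
  apply: (@squeeze_cvgr _ _ _ _ (fun=> 0) (fun z => C * z^-1)); last 2 first.
  - exact: cvg_cst.
  - rewrite -[X in _ --> X](mulr0 C); apply: cvgM; first exact: cvg_cst.
    apply/(gtr0_cvgV0 (f := fun z : R => z)); first exact: nbhs_pinfty_gt.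
    exact: cvg_id.
  - near=> z; have z0 : 0 < z by near: z; exact: nbhs_pinfty_gt.
    rewrite mulr_ge0 ?expR_ge0 ?exprn_ge0 ?(ltW z0)//= expRN mulrC.
    rewrite ler_pdivrMr ?expR_gt0// mulrAC ler_pdivlMr// -exprSr.
    have := @expR_ge1Dxn R (z / 2) i (divr_ge0 (ltW z0) (ler0n _ 2)).
    move=> /(ler_wpM2l C0); apply: le_trans.
    rewrite mulrDr -[leLHS]add0r lerD ?mulr1// /C.
    rewrite expr_div_n le_eqVlt; apply/orP; left; apply/eqP; field.
    by rewrite factf_neq0 expf_neq0.
rewrite [X in X @ _ --> _](_ : _ = fun z =>
    \sum_(i < size p) p`_i * (expR (- (z / 2)) * z ^+ i)); last first.
  by apply/funext => z; rewrite horner_coef mulr_sumr; apply: eq_bigr => i _; ring.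
rewrite -[X in _ --> X](@big1 R 0 +%R 'I_(size p) (index_enum _) xpredT (fun i => p`_i * 0)).
  apply: cvg_big => [|i _]; first exact: add_continuous.
  by apply: cvgM; [exact: cvg_cst|exact: mono].
by move=> i _; rewrite mulr0.
Unshelve. all: by end_near. Qed.

Lemma laguerre_poly_bound a n z : - 1 / 2 <= a -> 0 <= z ->
  `|expR (- (z / 2)) * (laguerre_poly a n).[z]| <=
  (2 * n%:R + a + 3) * `|(laguerre_poly a n).[0]|.
Proof.
move=> a_ge z0; set L := laguerre_poly a n.
pose v (z : R) := expR (- (z / 2)) * L.[z].
pose dv (z : R) := expR (- (z / 2)) * (L^`().[z] - L.[z] / 2).
pose ddv (z : R) := expR (- (z / 2)) * (L^`()^`().[z] - L^`().[z] + L.[z] / 4).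
have dexp (y : R) : is_derive y 1 (fun z => expR (- (z / 2))) (- (expR (- (y / 2)) / 2)).
  have H := @is_derive1_comp R expR (fun z => - (z / 2)) y _ _
    (is_derive_expR (- (y / 2))).
  by apply: is_derive_eq; rewrite /GRing.scale /=; field.
have vdv (y : R) : is_derive y 1 v (dv y).
  have HL := is_derive_poly L y.
  by apply: is_derive_eq; rewrite /GRing.scale /dv /=; field.
have dvddv (y : R) : is_derive y 1 dv (ddv y).
  have HL := is_derive_poly L y; have HdL := is_derive_poly L^`() y.
  by apply: is_derive_eq; rewrite /GRing.scale /ddv /=; field.
have b_ge : 1 / 2 <= a + 1 by lra.
have K_gt0 : 0 < n%:R + (a + 1) / 2 by rewrite ltr_wpDl// divr_gt0//; lra.
have ode y : y * ddv y + (a + 1) * dv y + (n%:R + (a + 1) / 2 - y / 4) * v y = 0.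
  have := laguerre_poly_ode a n => /(congr1 (fun p : {poly R} => p.[y])).
  rewrite horner0 !(hornerD, hornerZ, hornerM, hornerN, hornerC, hornerX) -/L => E.
  transitivity (expR (- (y / 2)) *
      (y * L^`()^`().[y] + (a + 1 - y) * L^`().[y] + n%:R * L.[y])).
    by rewrite /v /dv /ddv; field.
  by rewrite E mulr0.
have := sonin_bound b_ge K_gt0 vdv dvddv ode (cvg_poly_expRN L) z0.
rewrite /v mul0r oppr0 expR0 mul1r => /le_trans; apply.
by rewrite le_eqVlt; apply/orP; left; apply/eqP; field.
Qed.

End laguerre_bound.

(** * Polynomial growth of the Dunkl--Hermite functions *)

Section growth.
Context {R : realType}.
Implicit Types (a s z k : R) (n m N : nat).

Lemma bernoulli_le (A : nat) (x : R) : 0 <= x -> 1 + A%:R * x <= (1 + x) ^+ A.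
Proof.
move=> x0; elim: A => [|A IH]; first by rewrite mul0r addr0 expr0.
rewrite exprS; apply: le_trans (ler_wpM2l _ IH); last by rewrite addr_ge0.
rewrite -natr1; have : 0 <= A%:R * x ^+ 2 by rewrite mulr_ge0 ?exprn_ge0.
lra.
Qed.

(** $L_n^a(0)$ is the product of the $1 + a/i$ for $1 \le i \le n$, and
    $1 + A/i \le ((i+1)/i)^A$ telescopes to $(n+1)^A$. *)
Lemma laguerre_poly0_growth a : - 1 / 2 <= a ->
  exists A : nat, forall n, `|(laguerre_poly a n).[0]| <= n.+1%:R ^+ A.
Proof.
move=> a_ge; exists (Num.bound `|a|) => n.
have aA : a <= (Num.bound `|a|)%:R.
  by rewrite (le_trans (ler_norm a))// ltW// archi_boundP.
set A := Num.bound `|a| in aA *.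
rewrite laguerre_poly0 normr_prod; elim: n => [|n IH]; first by rewrite big_ord0 expr1n.
rewrite big_ord_recr/=; set c := (X in _ * X).
have n1 : (n.+1%:R : R) != 0 by rewrite pnatr_eq0.
have c_le : c <= (n.+2%:R / n.+1%:R) ^+ A.
  have n0 : (0 : R) <= n%:R by [].
  rewrite /c ger0_norm; last by rewrite divr_ge0// -natr1; lra.
  rewrite mulrDl divff// -[n.+2%:R]natr1 mulrDl divff// addrC.
  rewrite [leRHS](_ : _ = (1 + 1 / n.+1%:R) ^+ A)//.
  apply: le_trans (bernoulli_le _ _); last by rewrite divr_ge0.
  by rewrite lerD2l mul1r ler_wpM2r.
apply: le_trans (ler_pM _ _ IH c_le) _; [by rewrite prodr_ge0|exact: normr_ge0|].
by rewrite -exprMn mulrCA divff// mulr1.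
Qed.

Lemma laguerre_poly_three_term0 a :
  'X * laguerre_poly a 0 = (a + 1) *: laguerre_poly a 0 - laguerre_poly a 1.
Proof.
apply/polyP => j; rewrite coefXM coefB coefZ !coef_laguerre_poly /laguerre_coef.
case: j => [|[|j]]; rewrite /= ?(bin0, binn) ?bin_small// ?big_nat1 ?big_geq//.
- by rewrite expr0 fact0 !divr1; ring.
- by rewrite expr1 fact0 !divr1; ring.
- by ring.
Qed.

(** The three-term recurrence with all coefficients bounded by a multiple of
    $n + 1$. At $n = 0$ the term of index [n.-1] is a harmless repetition. *)
Lemma laguerre_poly_mulX_le a n z :
  `|z * (laguerre_poly a n).[z]| <= (3 + `|a|) * n.+1%:R *
    (`|(laguerre_poly a n).[z]| + `|(laguerre_poly a n.+1).[z]| +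
     `|(laguerre_poly a n.-1).[z]|).
Proof.
have n0 : (0 : R) <= n%:R by [].
have a0 := normr_ge0 a.
have na : 0 <= n%:R * `|a| by rewrite mulr_ge0.
have B1 : `|2 * n%:R + a + 1| <= (3 + `|a|) * n.+1%:R.
  have -> : 2 * n%:R + a + 1 = (2 * n%:R + 1) + a by ring.
  by rewrite (le_trans (ler_normD _ _))// ger0_norm -?natr1; lra.
have B2 : `|n.+1%:R| <= (3 + `|a|) * n.+1%:R :> R.
  by rewrite ger0_norm// ler_peMl//; lra.
have B3 : `|n%:R + a| <= (3 + `|a|) * n.+1%:R.
  by rewrite (le_trans (ler_normD _ _))// ger0_norm -?natr1; lra.
rewrite !mulrDr; case: n n0 na B1 B2 B3 => [|n] n0 na B1 B2 B3 /=.
  have := laguerre_poly_three_term0 a => /(congr1 (fun p : {poly R} => p.[z])).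
  rewrite !(hornerD, hornerZ, hornerM, hornerN, hornerC, hornerX) => ->.
  rewrite -[leLHS]addr0 lerD ?mulr_ge0 ?addr_ge0//.
  rewrite (le_trans (ler_normB _ _))// lerD//.
    by rewrite normrM ler_wpM2r//; move: B1; rewrite mulr0 add0r.
  by rewrite ler_peMl// mulr1; lra.
have := laguerre_poly_three_term a n => /(congr1 (fun p : {poly R} => p.[z])).
rewrite !(hornerD, hornerZ, hornerM, hornerN, hornerC, hornerX) => ->.
rewrite (le_trans (ler_normB _ _))// lerD//; last by rewrite normrM ler_wpM2r.
rewrite (le_trans (ler_normB _ _))// lerD//; rewrite normrM ler_wpM2r//.
Qed.

Definition laguerre_fun a n z : R := expR (- (z / 2)) * (laguerre_poly a n).[z].

(** Decay in [z] is bought with growth in [n]: by the three-term recurrence a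
    factor [z] only costs a factor of order $n$, and the case [N = 0] is Sonin's
    bound. *)
Lemma laguerre_fun_growth a N : - 1 / 2 <= a ->
  exists C (M : nat), 0 <= C /\
    forall n z, 0 <= z -> (1 + z) ^+ N * `|laguerre_fun a n z| <= C * n.+1%:R ^+ M.
Proof.
move=> a_ge; elim: N => [|N [C [M [C0 IH]]]].
  have [A HA] := laguerre_poly0_growth a_ge.
  exists (5 + `|a|), A.+1; split; first by rewrite addr_ge0.
  move=> n z z0; rewrite expr0 mul1r (le_trans (laguerre_poly_bound n a_ge z0))//.
  rewrite exprS mulrA ler_pM//; first by have : (0 : R) <= n%:R by []; lra.
  have an : 0 <= `|a| * n%:R by rewrite mulr_ge0.
  by have := ler_norm a; have : (0 : R) <= n%:R by []; rewrite -natr1; lra.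
exists ((1 + 3 * (3 + `|a|)) * (C * 2 ^+ M)), M.+1.
have B0 : 0 <= 3 + `|a| by rewrite addr_ge0.
split; first by rewrite !mulr_ge0 ?addr_ge0 ?mulr_ge0 ?exprn_ge0.
move=> n z z0.
have IH' m : (m <= n.+1)%N ->
    (1 + z) ^+ N * `|laguerre_fun a m z| <= (C * 2 ^+ M) * n.+1%:R ^+ M.
  move=> mn; rewrite (le_trans (IH m z z0))// -mulrA -exprMn ler_wpM2l//.
  rewrite lerXn2r ?nnegrE ?mulr_ge0// -natrM ler_nat mul2n -addnn.
  by rewrite addSn ltnS (leq_trans mn)// leq_addl.
set D := (C * 2 ^+ M) * n.+1%:R ^+ M in IH'.
have D0 : 0 <= D by rewrite !mulr_ge0 ?exprn_ge0.
have z1 : 0 <= (1 + z) ^+ N by rewrite exprn_ge0// addr_ge0.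
have e0 := expR_gt0 (- (z / 2)).
have zl : `|z * laguerre_fun a n z| <= (3 + `|a|) * n.+1%:R *
    (`|laguerre_fun a n z| + `|laguerre_fun a n.+1 z| + `|laguerre_fun a n.-1 z|).
  rewrite /laguerre_fun mulrCA normrM !(normrM (expR _)) -!mulrDr [leRHS]mulrCA.
  by rewrite ler_wpM2l// laguerre_poly_mulX_le.
have -> : (1 + z) ^+ N.+1 * `|laguerre_fun a n z| =
    (1 + z) ^+ N * `|laguerre_fun a n z| + (1 + z) ^+ N * `|z * laguerre_fun a n z|.
  by rewrite (normrM z) (ger0_norm z0) exprS; ring.
have H2 : (1 + z) ^+ N * `|z * laguerre_fun a n z| <= (3 + `|a|) * n.+1%:R * (D + D + D).
  apply: le_trans (ler_wpM2l z1 zl) _.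
  rewrite mulrCA ler_wpM2l ?mulr_ge0// !mulrDr !lerD// IH'//.
  by rewrite (leq_trans (leq_pred _)).
have H1 : D <= D * n.+1%:R by rewrite ler_peMr// ler1n.
apply: le_trans (lerD (IH' n (leqnSn n)) H2) _.
have -> : (1 + 3 * (3 + `|a|)) * (C * 2 ^+ M) * n.+1%:R ^+ M.+1 =
  D * n.+1%:R + (3 + `|a|) * n.+1%:R * (D + D + D) by rewrite exprS /D; ring.
by rewrite lerD2r.
Qed.

(** A form of Stirling's upper bound; the inductive step is
    $e^{-1/(m+2)} \ge 1 - 1/(m+2)$ raised to the power $m + 2$. *)
Lemma fact_expR_le m : m`!%:R * expR m%:R <= m.+1%:R ^+ m.+1 :> R.
Proof.
elim: m => [|m IH]; first by rewrite fact0 expR0 expr1 mulr1.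
rewrite factS natrM -[X in expR X]natr1 expRD.
have -> : m.+1%:R * m`!%:R * (expR m%:R * expR 1) =
  m.+1%:R * (m`!%:R * expR m%:R) * expR 1 :> R by ring.
apply: le_trans (_ : m.+1%:R * m.+1%:R ^+ m.+1 * expR 1 <= _).
  by rewrite ler_wpM2r ?expR_ge0// ler_wpM2l.
rewrite -exprS -ler_pdivlMl ?exprn_gt0// mulrC -expr_div_n.
have m2 : (m.+2%:R : R) != 0 by rewrite pnatr_eq0.
have -> : expR 1 = expR (m.+2%:R^-1) ^+ m.+2 :> R.
  by rewrite -expRM_natr mulVf.
rewrite lerXn2r ?nnegrE ?expR_ge0 ?divr_ge0//.
have := @expR_ge1Dx R (- m.+2%:R^-1); rewrite expRN.
have -> : 1 - m.+2%:R^-1 = m.+1%:R / m.+2%:R :> R.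
  by rewrite -[in RHS](addrK 1 m.+1%:R) natr1 mulrBl divff// mul1r.
move=> H; rewrite -[leRHS]invrK invf_div -[leLHS]invrK lef_pV2 ?posrE ?invr_gt0 ?expR_gt0//.
Qed.

(** Restricting Euler's integral to the unit interval $[m+1, m+2]$ loses only a
    power of $m + 1$. The proof separates a divergent integral, for which both
    [Gamma] and the quotient are $0$ by convention. *)
Lemma Gamma_growth s m : 1 / 2 <= s ->
  0 <= m`!%:R / Gamma (m%:R + s) <= 2 * expR 2 * m.+1%:R ^+ 2.
Proof.
move=> s_ge; set f := fun x : R => x `^ (m%:R + s - 1) * expR (- x).
have G0 : 0 <= Gamma (m%:R + s).
  by apply: Rintegral_ge0 => x _; rewrite mulr_ge0 ?powR_ge0 ?expR_ge0.
apply/andP; split; first by rewrite divr_ge0.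
pose c : R := m.+1%:R ^+ m / m.+2%:R * expR (- m.+2%:R).
have c0 : 0 < c by rewrite mulr_gt0 ?expR_gt0// divr_gt0// exprn_gt0.
have fc x : m.+1%:R <= x <= m.+2%:R -> c <= f x.
  move=> /andP[mx xm]; have x1 : 1 <= x by rewrite (le_trans _ mx)// ler1n.
  have x0 : 0 < x by rewrite (lt_le_trans _ x1).
  rewrite /c /f ler_pM ?expR_ge0 ?divr_ge0 ?exprn_ge0 ?ler_expR ?lerN2//.
  apply: (@le_trans _ _ (x `^ (m%:R - 1))); last first.
    by rewrite ler_powR// lerD2r; lra.
  rewrite powRB ?(gt_eqF x0) ?implybT// powR_mulrn ?(ltW x0)// powRr1 ?(ltW x0)//.
  by rewrite ler_pM ?exprn_ge0// ?lerXn2r ?nnegrE ?(ltW x0)// lef_pV2 ?posrE.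
have mf : measurable_fun (setT : set R) f.
  apply: measurable_funM; first exact: measurable_powR.
  by apply: measurableT_comp.
have [GE|cG] : Gamma (m%:R + s) = 0 \/ c <= Gamma (m%:R + s).
  rewrite /Gamma /Rintegral -/f.
  set I := (X in fine X).
  have : (c%:E <= I)%E.
    apply: (@le_trans _ _ (\int[lebesgue_measure]_(x in `[m.+1%:R, m.+2%:R]) (f x)%:E)%E).
      apply: (@le_trans _ _ (\int[lebesgue_measure]_(x in `[m.+1%:R : R, m.+2%:R]) c%:E)%E).
        rewrite integral_cst//= lebesgue_measure_itv/= lte_fin ltr_nat ltnS leqnn.
        by rewrite -EFinB -[m.+2%:R]natr1 addrAC subrr add0r mule1.
      apply: ge0_le_integral => //.
      - by move=> x _; rewrite lee_fin ltW.
      - by apply/measurable_EFinP; apply: measurable_funTS.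
    apply: ge0_subset_integral => //.
    - by apply/measurable_EFinP; apply: measurable_funTS.
    - by move=> x _; rewrite lee_fin mulr_ge0 ?powR_ge0 ?expR_ge0.
    - by move=> x; rewrite /= !in_itv/= andbT => /andP[+ _]; apply: lt_le_trans.
  by case: I => [r| |] //= cr; [right; rewrite -lee_fin|left].
  by rewrite GE invr0 mulr0 !mulr_ge0 ?expR_ge0 ?exprn_ge0.
rewrite ler_pdivrMr ?(lt_le_trans c0)//.
apply: le_trans (ler_wpM2l _ cG); last by rewrite !mulr_ge0 ?expR_ge0 ?exprn_ge0.
have H := fact_expR_le m.
have eE : expR 2 * expR (- m.+2%:R) = (expR m%:R)^-1 :> R.
  by rewrite -expRD -expRN -[m.+2]addn2 natrD opprD addrCA subrr addr0.
have -> : 2 * expR 2 * m.+1%:R ^+ 2 * c =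
    (m.+1%:R ^+ m.+1 * (expR 2 * expR (- m.+2%:R))) * (2 * m.+1%:R / m.+2%:R).
  by rewrite /c !exprS expr0; ring.
rewrite eE -[leLHS]mulr1 ler_pM//; first by rewrite ler_pdivlMr ?expR_gt0.
by rewrite ler_pdivlMr// mul1r -natrM ler_nat mul2n -addnn addSn ltnS leq_addl.
Qed.

(** Up to a normalization of polynomial growth, [dunkl_h k n y] is a Laguerre
    function at $y^2$, of parameter $k - 1/2$ for even [n] and $k + 1/2$ for odd
    [n], times [y] in the odd case; this last factor is absorbed by one more power
    of $1 + y^2$. *)
Lemma dunkl_h_growth k N : 0 <= k ->
  exists C (M : nat), 0 <= C /\
    forall n y, (1 + y ^+ 2) ^+ N * `|dunkl_h k n y| <= C * n.+1%:R ^+ M.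
Proof.
move=> k0.
have [|Ce [Me [Ce0 He]]] := @laguerre_fun_growth (k - 1 / 2) N; first by lra.
have [|Co [Mo [Co0 Ho]]] := @laguerre_fun_growth (k + 1 / 2) N.+1; first by lra.
(* The normalization is a square root, and $\sqrt r \le 1 + r$. *)
pose D : R := 1 + 2 * expR 2.
have D0 : 0 <= D by rewrite addr_ge0 ?mulr_ge0 ?expR_ge0.
have sqrt_le s m : 1 / 2 <= s ->
    `|Num.sqrt (m`!%:R / Gamma (m%:R + s))| <= D * m.+1%:R ^+ 2.
  move=> /(Gamma_growth m)/andP[g0 gle].
  rewrite ger0_norm ?sqrtr_ge0//.
  apply: (@le_trans _ _ (1 + m`!%:R / Gamma (m%:R + s))).
    rewrite -ler_sqr ?nnegrE ?sqrtr_ge0 ?addr_ge0// sqr_sqrtr//.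
    by move: g0; set u := _ / _ => u0; have := sqr_ge0 u; lra.
  by rewrite mulrDl mul1r lerD// exprn_ege1// ler1n.
have half n : n./2.+1%:R <= n.+1%:R :> R by rewrite ler_nat ltnS -divn2 leq_div.
exists (D * (Ce + Co)), (2 + Me + Mo)%N; split; first by rewrite mulr_ge0 ?addr_ge0.
move=> n y; rewrite /dunkl_h /dunkl_H; set m := n./2.
have y0 : 0 <= y ^+ 2 := sqr_ge0 y.
have fin (C : R) (M : nat) (M' x : R) : 0 <= C -> C <= Ce + Co -> (M <= Me + Mo)%N ->
    `|x| <= D * m.+1%:R ^+ 2 -> M' <= C * m.+1%:R ^+ M -> 0 <= M' ->
    `|x| * M' <= D * (Ce + Co) * n.+1%:R ^+ (2 + Me + Mo).
  move=> C0 CC MM xD M'C M'0.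
  apply: (@le_trans _ _ ((D * m.+1%:R ^+ 2) * (C * m.+1%:R ^+ M))); first by rewrite ler_pM.
  have -> : D * m.+1%:R ^+ 2 * (C * m.+1%:R ^+ M) = D * C * m.+1%:R ^+ (2 + M).
    by rewrite exprD; ring.
  rewrite ler_pM ?exprn_ge0 ?(mulr_ge0 D0 C0) ?ler_wpM2l//.
  apply: (@le_trans _ _ (n.+1%:R ^+ (2 + M))); first by rewrite lerXn2r ?nnegrE//; exact: half.
  by rewrite ler_weXn2l ?ler1n// -addnA leq_add2l.
case: ifP => _; rewrite laguerre_polyE.
- rewrite !normrM normrX normrN1 expr1n.
  rewrite [leLHS](_ : _ = `|Num.sqrt (m`!%:R / Gamma (m%:R + k + 3 / 2))| *
    ((1 + y ^+ 2) ^+ N * (`|y| * `|laguerre_fun (k + 1 / 2) m (y ^+ 2)|))); last first.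
    by rewrite /laguerre_fun normrM; ring.
  apply: (fin Co Mo); rewrite ?lerDr ?leq_addl//.
  + by rewrite -addrA sqrt_le//; lra.
  + apply: le_trans (Ho m _ y0); rewrite (exprSr _ N) -mulrA.
    rewrite ler_wpM2l ?exprn_ge0 ?addr_ge0// ler_wpM2r//.
    rewrite -(real_normK (num_real y)).
    by have := sqr_ge0 (`|y| - 1); have := sqr_ge0 `|y|; lra.
  + by rewrite mulr_ge0 ?(exprn_ge0 _ (addr_ge0 ler01 y0)) ?mulr_ge0.
- rewrite !normrM normrX normrN1 expr1n.
  rewrite [leLHS](_ : _ = `|Num.sqrt (m`!%:R / Gamma (m%:R + k + 1 / 2))| *
    ((1 + y ^+ 2) ^+ N * `|laguerre_fun (k - 1 / 2) m (y ^+ 2)|)); last first.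
    by rewrite /laguerre_fun normrM; ring.
  apply: (fin Ce Me); rewrite ?lerDl ?leq_addr//.
  + by rewrite -addrA sqrt_le//; lra.
  + exact: He.
  + by rewrite mulr_ge0 ?(exprn_ge0 _ (addr_ge0 ler01 y0)).
Qed.

End growth.

(** * Summability and termwise integration *)

Section summability.
Context {R : realType}.

Lemma is_cvg_series_telescoping :
  cvgn (series (fun n => (n.+1%:R * n.+2%:R)^-1 : R)).
Proof.
have E : series (fun n => (n.+1%:R * n.+2%:R)^-1 : R) = fun n => 1 - n.+1%:R^-1.
  apply/funext; elim=> [|n IH]; first by rewrite /series/= big_geq// invr1 subrr.
  rewrite seriesS IH; field.
  by rewrite nat1r -natrD !pnatr_eq0.
rewrite E; apply: is_cvgB; first exact: is_cvg_cst.
by apply/cvg_ex; exists 0; exact: cvg_harmonic.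
Qed.

(** A stretched exponential beats every power: with $\lambda \ge \sqrt{n+1}$, the
    term of degree $2M + 4$ of the series of $e^{t\lambda}$ is at least a multiple
    of $(n+1)^{M+2}$, which leaves a multiple of $1/(n+1)^2$. *)
Lemma is_cvg_series_expR_sqrt (k t : R) (M : nat) : 0 <= k -> 0 < t ->
  cvgn (series (fun n => expR (- t * Num.sqrt (2 * n%:R + 2 * k + 1)) * n.+1%:R ^+ M)).
Proof.
move=> k0 t0.
pose J := (2 * M.+2)%N.
pose C : R := J`!%:R / t ^+ J.
have C0 : 0 < C by rewrite divr_gt0 ?exprn_gt0// ltr0n fact_gt0.
apply: (@series_le_cvg _ _ (fun n => 2 * C * (n.+1%:R * n.+2%:R)^-1)).
- by move=> n; rewrite mulr_ge0 ?expR_ge0 ?exprn_ge0.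
- by move=> n; rewrite mulr_ge0 ?invr_ge0 ?(mulr_ge0 _ (ltW C0)) ?mulr_ge0.
- move=> n; set l := Num.sqrt _.
  have n0 : (0 : R) <= n%:R by [].
  have l2 : n.+1%:R <= l ^+ 2 by rewrite sqr_sqrtr -?natr1; lra.
  have l0 : 0 <= l by exact: sqrtr_ge0.
  have n1 : (0 : R) < n.+1%:R by [].
  have H : n.+1%:R ^+ M.+2 / C <= expR (t * l).
    have tl0 : 0 <= t * l by rewrite mulr_ge0// ltW.
    apply: le_trans (expR_ge1Dxn (2 * M.+2).-1 tl0).
    rewrite -[leLHS]add0r lerD// prednK ?muln_gt0// -/J.
    rewrite /C invf_div mulrA ler_pM2r ?invr_gt0 ?ltr0n ?fact_gt0//.
    rewrite exprMn mulrC ler_pM2l ?exprn_gt0// /J exprM.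
    by rewrite lerXn2r ?nnegrE ?sqr_ge0.
  rewrite mulNr expRN mulrC ler_pdivrMr ?expR_gt0//.
  apply: le_trans (ler_wpM2l _ H); last first.
    by rewrite mulr_ge0 ?invr_ge0 ?(mulr_ge0 _ (ltW C0)) ?mulr_ge0.
  rewrite [leRHS](_ : _ = n.+1%:R ^+ M * (2 * n.+1%:R / n.+2%:R)).
    rewrite -[leLHS]mulr1 ler_wpM2l ?exprn_ge0// ler_pdivlMr// mul1r.
    by rewrite -natrM ler_nat mul2n -addnn addSn ltnS leq_addl.
  rewrite !exprS; field.
  by rewrite nat1r -natrD !pnatr_eq0 (gt_eqF C0).
- exact/is_cvg_seriesZ/is_cvg_series_telescoping.
Qed.

End summability.

Section integral_series.
Context d (T : measurableType d) (R : realType).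
Variables (mu : {measure set T -> \bar R}) (D : set T) (mD : measurable D).
Variables (g : nat -> T -> R) (B : nat -> R).
Hypothesis ig : forall n, mu.-integrable D (EFin \o g n).
Hypothesis gB : forall n, (\int[mu]_(x in D) (`|g n x|)%:E <= (B n)%:E)%E.
Hypothesis cB : cvgn (series B).
Hypothesis cg : forall x, D x -> cvgn (series (fun n => `|g n x|)).

(** Fubini for a series and an integral: the sum of the $|g_n|$ is integrable by
    monotone convergence, and it dominates the partial sums. *)
Lemma integral_series :
  mu.-integrable D (fun x => (limn (series (g^~ x)))%:E) /\
  series (fun n => \int[mu]_(x in D) g n x) @ \oo -->
    \int[mu]_(x in D) limn (series (g^~ x)).
Proof.
pose h (x : T) : \bar R := (\sum_(n <oo) (`|g n x|)%:E)%E.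
have mg n : measurable_fun D (g n) by apply/measurable_EFinP; case/integrableP : (ig n).
have mgn n : measurable_fun D (fun x => (`|g n x|)%:E).
  by apply/measurable_EFinP; exact: measurableT_comp.
have ih : mu.-integrable D h.
  apply/integrableP; split.
    by apply: ge0_emeasurable_sum => // n x _.
  under eq_integral.
    move=> x _; rewrite gee0_abs; last by apply: nneseries_ge0.
    over.
  rewrite integral_nneseries//.
  apply: (@le_lt_trans _ _ (\sum_(n <oo) (B n)%:E)%E).
    by apply: lee_nneseries => // n _; rewrite integral_ge0.
  rewrite (_ : (fun n => \sum_(0 <= k < n) (B k)%:E)%E = EFin \o series B).
    by rewrite EFin_lim// ltry.
  by apply/funext => n; rewrite /= sumEFin.
have cvg_g x : D x -> series (g^~ x) @ \oo --> limn (series (g^~ x)).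
  by move=> Dx; apply: normed_cvg; exact: cg.
have ms n : measurable_fun D (fun x => series (g^~ x) n).
  by apply: measurable_sum => i; exact: mg.
have mlim : measurable_fun D (fun x => limn (series (g^~ x))).
  by apply: (measurable_fun_cvg ms) => x /cvg_g.
have [|||||ilim _ cvg_int] := @dominated_convergence _ _ _ mu D mD
  (fun n x => (series (g^~ x) n)%:E) (fun x => (limn (series (g^~ x)))%:E) h.
- by move=> n; apply/measurable_EFinP.
- exact/measurable_EFinP.
- by apply: aeW => x Dx; apply: cvg_EFin; [exact: nearW|exact: cvg_g].
- exact: ih.
- apply: aeW => x n Dx.
  apply: (@le_trans _ _ (\sum_(0 <= k < n) (`|g k x|)%:E)%E).
    by rewrite sumEFin lee_fin ler_norm_sum.
  exact: nneseries_lim_ge.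
split => //.
have fin_int : (\int[mu]_(x in D) (limn (series (g^~ x)))%:E)%E \is a fin_num.
  exact: integrable_fin_num.
rewrite -(fineK fin_int) in cvg_int.
have := @fine_cvg _ _ _ _ _ _ cvg_int.
rewrite (_ : fine \o _ = series (fun n => \int[mu]_(x in D) g n x)); first by apply.
apply/funext => n; rewrite /= /series /=.
under eq_integral do rewrite -sumEFin.
rewrite integral_sum//.
rewrite (eq_bigr (fun k => (\int[mu]_(x in D) g k x)%:E)) ?sumEFin// => k _.
by rewrite /Rintegral fineK//; exact: (integrable_fin_num mD (ig k)).
Qed.

End integral_series.

(** * The subordination formula *)

Section gauss_primitive.
Context {R : realType}.
Notation mu := (@lebesgue_measure R).

(** The error function, up to normalization. Its limit at infinity exists since
    $e^{-s^2} \le 1/(1+s^2)$ keeps it below the arctangent, and it is then given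
    by the Gauss integral. *)
Lemma gauss_primitive : exists Psi : R -> R,
  [/\ forall s : R, is_derive s 1 Psi (gauss_fun s),
      Psi s @[s --> +oo] --> Num.sqrt pi / 2 &
      Psi s @[s --> -oo] --> - (Num.sqrt pi / 2)].
Proof.
pose Phi s := (\int[mu]_(x in `]-oo, s]) gauss_fun x)%R.
pose Psi s := Phi s - Phi 0.
have dPhi (s : R) : is_derive s 1 Phi (gauss_fun s).
  have [||||dP <-] := @continuous_FTC1 R gauss_fun -oo%O s (s + 1).
  - by rewrite ltrDl.
  - by apply: integrableS (integrableT_gauss).
  - by rewrite ltNyr.
  - exact: continuous_gauss_fun.
  by rewrite derive1E; exact: derivableP.
have dPsi (s : R) : is_derive s 1 Psi (gauss_fun s).
  by apply: is_derive_eq; rewrite subr0.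
have Psi0 : Psi 0 = 0 by rewrite /Psi subrr.
have PsiN s : Psi (- s) = - Psi s.
  apply/eqP; rewrite -subr_eq0 opprK; apply/eqP.
  have dS (x : R) : is_derive x 1 (fun s => Psi (- s) + Psi s) 0.
    have H := @is_derive1_comp R Psi (@GRing.opp R) x _ _ (dPsi (- x)) (is_deriveNid x 1).
    by apply: is_derive_eq; rewrite /gauss_fun sqrrN mulrN1 addNr.
  by have := is_derive_0_is_cst s 0 dS; rewrite oppr0 Psi0 addr0.
have ndPsi : nondecreasing_fun Psi.
  by move=> x y xy; apply: (ler_is_derive xy (fun z _ => dPsi z)) => z _; exact: gauss_fun_ge0.
have Psi_le s : Psi s <= pi / 2.
  have [s0|/ltW s0] := leP 0 s; last first.
    by rewrite (le_trans (ndPsi _ _ s0))// Psi0 divr_ge0// pi_ge0.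
  apply: (@le_trans _ _ (atan s)); last by rewrite ltW// atan_ltpi2.
  rewrite -subr_ge0; apply: (@le_trans _ _ (atan 0 - Psi 0)).
    by rewrite atan0 Psi0 subrr.
  apply: (@ler_is_derive _ (fun s => atan s - Psi s)
    (fun s => (1 + s ^+ 2)^-1 - gauss_fun s)) => //.
  move=> z _; rewrite subr_ge0 /gauss_fun expRN lef_pV2 ?posrE ?expR_gt0 ?expR_ge1Dx//.
  by rewrite (lt_le_trans ltr01)// lerDl sqr_ge0.
have cvgPsi : Psi s @[s --> +oo] --> sup (range Psi).
  by apply: nondecreasing_cvgr => //; exists (pi / 2) => _ [s _ <-].
have supE : sup (range Psi) = Num.sqrt pi / 2.
  have := @ge0_continuous_FTC2y R gauss_fun Psi 0 _ (fun x _ => gauss_fun_ge0 x) _ cvgPsi.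
  rewrite integral0y_gauss Psi0 sube0 => H; apply/esym; apply: EFin_inj; apply: H.
  - by apply: continuous_subspaceT; exact: continuous_gauss_fun.
  - by move=> x _; case: (dPsi x).
  - apply: cvg_at_right_filter.
    have : {for 0, continuous Psi}.
      by apply: differentiable_continuous; apply/derivable1_diffP; case: (dPsi 0).
    by rewrite /prop_for /continuous_at Psi0.
  - by move=> x _; rewrite derive1E; apply: derive_val.
exists Psi; split => //; first by rewrite -supE.
apply/cvgNy_compNP; rewrite -supE.
rewrite (_ : Psi \o _ = fun s => - Psi s); first exact: cvgN.
by apply/funext => s; rewrite /= PsiN.
Qed.

End gauss_primitive.

Section subordination.
Context {R : realType}.
Notation mu := (@lebesgue_measure R).

Lemma cvgy_powR_half : u `^ 2^-1 @[u --> +oo] --> (+oo : set_system R).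
Proof.
apply/cvgryPge => A; near=> u.
have u0 : 0 <= u by near: u; exact: nbhs_pinfty_ge.
rewrite powR12_sqrt// (le_trans (ler_norm A))// -sqrtr_sqr ler_sqrt//.
Unshelve. all: by end_near. Qed.

Lemma cvg0_powRN_half : u `^ (- 2^-1) @[u --> (0:R)^'+] --> (+oo : set_system R).
Proof.
rewrite (_ : (fun u => _) = (fun u : R => (u `^ 2^-1)^-1)); last first.
  by apply/funext => u; rewrite powRN.
apply/(cvgrVy (f := fun u => u `^ 2^-1)); last by apply: powR_cvg0; rewrite invr_gt0.
by near=> u; apply: powR_gt0; near: u; exact: nbhs_right_gt.
Unshelve. all: by end_near. Qed.

Lemma powR_half_mulN (u : R) : 0 < u ->
  [/\ u `^ 2^-1 * u `^ (- 2^-1) = 1, (u `^ 2^-1) ^+ 2 = u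
    & (u `^ (- 2^-1)) ^+ 2 = u^-1].
Proof.
move=> u0; have un0 : u != 0 by rewrite gt_eqF.
split.
- by rewrite -powRD ?un0 ?implybT// subrr powRr0.
- by rewrite powR12_sqrt ?sqr_sqrtr// ltW.
- by rewrite powRN exprVn powR12_sqrt ?sqr_sqrtr// ltW.
Qed.

(** The density of the one-sided stable law of index $1/2$, times the heat factor
    of an eigenvalue $l^2$. *)
Definition subordinator (t l u : R) : R := t / Num.sqrt (4 * pi) *
  (u `^ (- (3 / 2)) * expR (- (t ^+ 2 / (4 * u))) * expR (- u * l ^+ 2)).

Lemma subordinator_ge0 (t l u : R) : 0 < t -> 0 <= subordinator t l u.
Proof.
move=> t0; apply: mulr_ge0; first by rewrite divr_ge0 ?sqrtr_ge0// ltW.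
by rewrite mulr_ge0 ?expR_ge0// mulr_ge0 ?expR_ge0 ?powR_ge0.
Qed.

Lemma continuous_subordinator (t l u : R) : 0 < u ->
  {for u, continuous (subordinator t l)}.
Proof.
move=> u0; have [d1 _] := @is_derive1_powR R (- (3 / 2)) u u0.
have cp : {for u, continuous (fun w => w `^ (- (3 / 2)))}.
  exact/differentiable_continuous/derivable1_diffP.
apply: cvgM; first exact: cvg_cst.
apply: cvgM; first apply: cvgM.
- exact: cp.
- apply: continuous_cvg; first exact: continuous_expR.
  apply: cvgN; apply: cvgM; first exact: cvg_cst.
  apply: cvgV; first by rewrite mulf_neq0// gt_eqF.
  by apply: cvgM; [exact: cvg_cst|exact: cvg_id].
- apply: continuous_cvg; first exact: continuous_expR.
  by apply: cvgM; [apply: cvgN; exact: cvg_id|exact: cvg_cst].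
Qed.

Lemma measurable_subordinator (t l : R) :
  measurable_fun (`]0%R, +oo[ : set R) (subordinator t l).
Proof.
apply: open_continuous_measurable_fun => // u.
by rewrite inE/= in_itv/= andbT; exact: continuous_subordinator.
Qed.

(** With $a = t/2$ and $s_\pm(u) = \pm l\sqrt u - a/\sqrt u$ one has
    $s_\pm(u)^2 = l^2 u + a^2/u \mp tl$. Hence, for a primitive [Psi] of
    $e^{-s^2}$, the integrand is the derivative of
    $(e^{-tl}\,\Psi(s_+) + e^{tl}\,\Psi(s_-))/\sqrt\pi$. As $u$ runs from $0$
    to infinity, $s_+$ goes from $-\infty$ to $+\infty$ while $s_-$ comes back to
    $-\infty$, so only the first term contributes. *)
Lemma integral_subordinator (t l : R) : 0 < t -> 0 < l ->
  (\int[mu]_(u in `]0%R, +oo[) (subordinator t l u)%:E = (expR (- t * l))%:E)%E.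
Proof.
move=> t0 l0; pose a := t / 2; have a0 : 0 < a by rewrite divr_gt0.
set f := subordinator t l.
have spi : 0 < Num.sqrt pi :> R by rewrite sqrtr_gt0 pi_gt0.
have cE : t / Num.sqrt (4 * pi) = a / Num.sqrt pi.
  have -> : Num.sqrt (4 * pi) = 2 * Num.sqrt pi :> R.
    by rewrite sqrtrM// (_ : 4 = 2 ^+ 2) ?sqrtr_sqr ?ger0_norm// expr2 -natrM.
  by rewrite /a; field; rewrite gt_eqF.
have f0 u : 0 <= f u := subordinator_ge0 l u t0.
have [Psi [dPsi Psi_y Psi_Ny]] := @gauss_primitive R.
pose s1 (u : R) := l * u `^ 2^-1 - a * u `^ (- 2^-1).
pose s2 (u : R) := - (l * u `^ 2^-1) - a * u `^ (- 2^-1).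
pose G (u : R) := (expR (- t * l) * Psi (s1 u) + expR (t * l) * Psi (s2 u)) / Num.sqrt pi.
pose c := (expR (- t * l) * - (Num.sqrt pi / 2) +
  expR (t * l) * - (Num.sqrt pi / 2)) / Num.sqrt pi.
(* [F] extends [G] to $u = 0$ by its right limit [c]. *)
pose F (u : R) := if u <= 0 then c else G u.
have FG (u : R) : 0 < u -> F u = G u by move=> u0; rewrite /F leNgt u0.
have dG (u : R) : 0 < u -> is_derive u 1 G (f u).
  move=> u0; have [h1 h2 h3] := powR_half_mulN u0.
  have d1 := @is_derive1_powR R 2^-1 u u0.
  have d2 := @is_derive1_powR R (- 2^-1) u u0.
  have ds1 : is_derive u 1 s1
      (l * (2^-1 * u `^ (2^-1 - 1)) - a * (- 2^-1 * u `^ (- 2^-1 - 1))).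
    by apply: is_derive_eq; rewrite /GRing.scale /=; ring.
  have ds2 : is_derive u 1 s2
      (- (l * (2^-1 * u `^ (2^-1 - 1))) - a * (- 2^-1 * u `^ (- 2^-1 - 1))).
    by apply: is_derive_eq; rewrite /GRing.scale /=; ring.
  have dp1 := @is_derive1_comp R Psi s1 u _ _ (dPsi (s1 u)) ds1.
  have dp2 := @is_derive1_comp R Psi s2 u _ _ (dPsi (s2 u)) ds2.
  have e1 : expR (- t * l) * gauss_fun (s1 u) =
      expR (- (t ^+ 2 / (4 * u))) * expR (- u * l ^+ 2).
    rewrite -!expRD; congr expR.
    have -> : s1 u ^+ 2 = l ^+ 2 * (u `^ 2^-1) ^+ 2 -
        2 * a * l * (u `^ 2^-1 * u `^ (- 2^-1)) + a ^+ 2 * (u `^ (- 2^-1)) ^+ 2.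
      by rewrite /s1; ring.
    by rewrite h1 h2 h3 /a; field; rewrite gt_eqF.
  have e2 : expR (t * l) * gauss_fun (s2 u) =
      expR (- (t ^+ 2 / (4 * u))) * expR (- u * l ^+ 2).
    rewrite -!expRD; congr expR.
    have -> : s2 u ^+ 2 = l ^+ 2 * (u `^ 2^-1) ^+ 2 +
        2 * a * l * (u `^ 2^-1 * u `^ (- 2^-1)) + a ^+ 2 * (u `^ (- 2^-1)) ^+ 2.
      by rewrite /s2; ring.
    by rewrite h1 h2 h3 /a; field; rewrite gt_eqF.
  have p3 : u `^ (- (3 / 2)) = u `^ (- 2^-1 - 1) by congr (_ `^ _); field.
  rewrite /G /f /subordinator p3 cE; apply: is_derive_eq; rewrite /GRing.scale /=.
  set w := u `^ (- 2^-1 - 1); set w' := u `^ (2^-1 - 1).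
  transitivity ((Num.sqrt pi)^-1 *
    (expR (- t * l) * gauss_fun (s1 u) * (l * (2^-1 * w') - a * (- 2^-1 * w)) +
     expR (t * l) * gauss_fun (s2 u) * (- (l * (2^-1 * w')) - a * (- 2^-1 * w)))).
    by ring.
  by rewrite e1 e2; field; rewrite gt_eqF.
have dF (u : R) : 0 < u -> is_derive u 1 F (f u).
  move=> u0; apply: near_eq_is_derive (dG u u0).
  by near=> w; apply/esym/FG; near: w; exact: lt_nbhsr.
have r_y (A : R) : \forall u \near +oo, A <= u `^ 2^-1.
  exact: (proj1 (cvgryPge _) cvgy_powR_half).
have v_0 (A : R) : \forall u \near (0:R)^'+, A <= u `^ (- 2^-1).
  exact: (proj1 (cvgryPge _) cvg0_powRN_half).
have s1_y : s1 u @[u --> +oo] --> (+oo : set_system R).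
  apply/cvgryPge => A; near=> u.
  have r1 : 1 <= u `^ 2^-1 by near: u; exact: r_y.
  have rA : (A + a) / l <= u `^ 2^-1 by near: u; exact: r_y.
  have v1 : u `^ (- 2^-1) <= 1 by rewrite powRN invf_le1// (lt_le_trans ltr01).
  move: rA; rewrite ler_pdivrMr// /s1 lerBrDr mulrC; apply: le_trans.
  by rewrite lerD2l ler_piMr// ltW.
have s2_y : s2 u @[u --> +oo] --> (-oo : set_system R).
  apply/cvgrNyPle => A; near=> u.
  have rA : - A / l <= u `^ 2^-1 by near: u; exact: r_y.
  move: rA; rewrite ler_pdivrMr// /s2 lerNl mulrC => rA.
  by rewrite (le_trans _ rA)// gerBl mulr_ge0 ?powR_ge0// ltW.
have s2_0 : s2 u @[u --> (0:R)^'+] --> (-oo : set_system R).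
  apply/cvgrNyPle => A; near=> u.
  have vA : - A / a <= u `^ (- 2^-1) by near: u; exact: v_0.
  move: vA; rewrite ler_pdivrMr// /s2 lerNl mulrC => vA.
  by rewrite (le_trans _ vA)// gerDr oppr_le0 mulr_ge0 ?powR_ge0// ltW.
have s1_0 : s1 u @[u --> (0:R)^'+] --> (-oo : set_system R).
  apply/cvgrNyPle => A; near=> u.
  have vA : (l - A) / a <= u `^ (- 2^-1) by near: u; exact: v_0.
  have v1 : 1 <= u `^ (- 2^-1) by near: u; exact: v_0.
  have r1 : u `^ 2^-1 <= 1.
    by rewrite -[2^-1]opprK powRN invf_le1// (lt_le_trans ltr01).
  move: vA; rewrite ler_pdivrMr// /s1 mulrC lerBlDl => vA.
  by rewrite lerBlDr (le_trans _ vA)// ler_piMr// ltW.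
have G_lim (FF : set_system R) (HF : Filter FF) (p q : R) :
    Psi (s1 u) @[u --> FF] --> p -> Psi (s2 u) @[u --> FF] --> q ->
    G u @[u --> FF] --> (expR (- t * l) * p + expR (t * l) * q) / Num.sqrt pi.
  move=> cA cB; apply: cvgM; last exact: cvg_cst.
  by apply: cvgD; (apply: cvgM; first exact: cvg_cst).
(* At $0$ the power takes the value $0$, so [f] is continuous from the right
   there: $e^{-r} \le 2/r^2$ for $r = t^2/(4u)$ bounds it by a multiple of
   $\sqrt u$. *)
have f_0 : f u @[u --> 0^'+] --> f 0.
  have -> : f 0 = 0 by rewrite /f /subordinator powR0 ?mul0r ?mulr0// oppr_eq0 mulf_neq0.
  pose C := a / Num.sqrt pi * (32 / t ^+ 4).
  apply: (@squeeze_cvgr _ _ _ _ (fun=> 0) (fun u => C * u `^ 2^-1)); last 2 first.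
  - exact: cvg_cst.
  - rewrite -[X in _ --> X](mulr0 C); apply: cvgM; first exact: cvg_cst.
    by apply: powR_cvg0; rewrite invr_gt0.
  near=> u; rewrite f0 /=; have u0 : 0 < u by near: u; exact: nbhs_right_gt.
  rewrite /f /subordinator cE /C -[leRHS]mulrA ler_wpM2l//; first by rewrite divr_ge0 ?ltW.
  rewrite -[leRHS]mulr1 ler_pM ?mulr_ge0 ?powR_ge0 ?expR_ge0//; last first.
    by rewrite -expR0 ler_expR mulNr oppr_le0 mulr_ge0 ?sqr_ge0// ltW.
  have u2 : u `^ 2^-1 = u `^ (- (3 / 2)) * u ^+ 2.
    rewrite -(powR_mulrn _ (ltW u0)) -powRD ?(gt_eqF u0) ?implybT//.
    by congr (_ `^ _); field.
  rewrite u2 mulrCA ler_wpM2l ?powR_ge0// expRN.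
  have y0 : 0 <= t ^+ 2 / (4 * u) by rewrite divr_ge0 ?sqr_ge0// mulr_ge0// ltW.
  rewrite -[leLHS]mul1r ler_pdivrMr ?expR_gt0//.
  have y1 : (t ^+ 2 / (4 * u)) ^+ 2 / 2 <= expR (t ^+ 2 / (4 * u)).
    by apply: le_trans (expR_ge1Dxn 1 y0); rewrite lerDr.
  apply: le_trans (ler_wpM2l _ y1); last first.
    by rewrite mulr_ge0 ?sqr_ge0// divr_ge0// exprn_ge0// ltW.
  rewrite le_eqVlt; apply/orP; left; apply/eqP; field.
  by rewrite !gt_eqF.
transitivity (\int[mu]_(u in `[0%R, +oo[) (f u)%:E)%E.
  apply: (@integral_itv_obnd_cbnd R 0 +oo%O (EFin \o f)).
  by apply/measurable_EFinP; exact: measurable_subordinator.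
rewrite (@ge0_continuous_FTC2y _ f F 0 ((expR (- t * l) * (Num.sqrt pi / 2) +
  expR (t * l) * - (Num.sqrt pi / 2)) / Num.sqrt pi)).
- rewrite /F lexx -EFinB; congr EFin; rewrite /c; field.
  by rewrite gt_eqF.
- by [].
- apply/continuous_within_itvcyP; split => // u.
  by rewrite in_itv/= andbT; exact: continuous_subordinator.
- apply: cvg_trans (G_lim _ _ _ _ (cvg_comp _ _ s1_y Psi_y) (cvg_comp _ _ s2_y Psi_Ny)).
  apply: near_eq_cvg; near=> u; apply/esym/FG.
  by near: u; exact: nbhs_pinfty_gt.
- by move=> u u0; case: (dF u u0).
- have -> : F 0 = c by rewrite /F lexx.
  apply: cvg_trans (G_lim _ _ _ _ (cvg_comp _ _ s1_0 Psi_Ny) (cvg_comp _ _ s2_0 Psi_Ny)).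
  apply: near_eq_cvg; near=> u; apply/esym/FG.
  by near: u; exact: nbhs_right_gt.
- by move=> u; rewrite in_itv/= andbT derive1E => /dF dFu; exact: derive_val.
Unshelve. all: by end_near. Qed.

End subordination.

(** * Bounds for the Dunkl expansion *)

Section dunkl_bounds.
Context {R : realType}.
Notation mu := (@lebesgue_measure R).
Implicit Types (k t u x y : R) (n : nat).

Definition eigenfreq k n : R := Num.sqrt (2 * n%:R + 2 * k + 1).

Lemma eigenfreq_ge1 k n : 0 <= k -> 1 <= eigenfreq k n.
Proof.
move=> k0; rewrite /eigenfreq -[leLHS]sqrtr1 ler_wsqrtr//.
by have : (0 : R) <= n%:R by []; lra.
Qed.

Lemma sqr_eigenfreq k n : 0 <= k -> eigenfreq k n ^+ 2 = 2 * n%:R + 2 * k + 1.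
Proof. by move=> k0; rewrite sqr_sqrtr// !addr_ge0 ?mulr_ge0. Qed.

Lemma dunkl_weight_le k y N : 0 <= k -> k <= N%:R ->
  dunkl_weight k y <= (1 + y ^+ 2) ^+ N.
Proof.
move=> k0 kN; have y0 := sqr_ge0 y.
have y1 : 1 <= 1 + y ^+ 2 by rewrite lerDl.
rewrite /dunkl_weight powRrM.
apply: (@le_trans _ _ ((1 + y ^+ 2) `^ k)).
  apply: ge0_ler_powR; rewrite ?nnegrE ?powR_ge0 ?addr_ge0//.
  by rewrite (@powR_mulrn _ _ 2)// real_normK ?num_real// lerDr.
by rewrite -(@powR_mulrn _ (1 + y ^+ 2) N) ?addr_ge0// ler_powR.
Qed.

Lemma dunkl_weight_ge0 k y : 0 <= dunkl_weight k y.
Proof. exact: powR_ge0. Qed.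

(** Both bounds follow from the decay of order $(1+y^2)^{-N-1}$, where [N] is
    large enough for the weight to be at most $(1+y^2)^N$. *)
Lemma dunkl_h_bound k : 0 <= k -> exists C (M : nat), 0 <= C /\
  forall n y, `|dunkl_h k n y| <= C * n.+1%:R ^+ M /\
    `|dunkl_h k n y| * dunkl_weight k y <= C * n.+1%:R ^+ M / (1 + y ^+ 2).
Proof.
move=> k0; set N := Num.bound k.
have kN : k <= N%:R by rewrite ltW// archi_boundP.
have [C [M [C0 H]]] := dunkl_h_growth N.+1 k0.
exists C, M; split => // n y.
have y1 : 1 <= 1 + y ^+ 2 by rewrite lerDl sqr_ge0.
have y0 : 0 < 1 + y ^+ 2 by rewrite (lt_le_trans ltr01).
split; first by apply: le_trans (H n y); rewrite ler_peMl// exprn_ege1.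
rewrite ler_pdivlMr//; apply: le_trans (H n y).
rewrite mulrC (exprS _ N) -mulrA ler_wpM2l ?(ltW y0)// mulrC.
by rewrite ler_wpM2r// dunkl_weight_le.
Qed.

Lemma measurable_dunkl_h k n : measurable_fun setT (dunkl_h k n).
Proof.
have msqr : measurable_fun setT (fun x : R => x ^+ 2) by exact: measurable_funX.
have mh (q : {poly R}) : measurable_fun setT (fun x : R => q.[x ^+ 2]).
  have mq : measurable_fun [set: R] (horner q) by exact: measurable_poly.
  exact: (measurableT_comp mq msqr).
rewrite /dunkl_h /dunkl_H; apply: measurable_funM.
  apply: measurableT_comp => //; apply: measurable_funN.
  exact: measurable_funM.
case: (odd n); apply: measurable_funM; [|exact: mh| |exact: mh]; last exact: measurable_cst.
exact: measurable_funM.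
Qed.

Lemma measurable_dunkl_weight k : measurable_fun setT (dunkl_weight k).
Proof. exact: (measurableT_comp (measurable_powR _)). Qed.

Lemma integrable_oneDsqrV : mu.-integrable setT (fun y : R => ((1 + y ^+ 2)^-1)%:E).
Proof.
have y0 (y : R) : 0 <= (1 + y ^+ 2)^-1 by rewrite invr_ge0 addr_ge0 ?sqr_ge0.
have c : continuous (fun y : R => (1 + y ^+ 2)^-1) by exact: continuous_oneDsqrV.
apply/integrableP; split.
  by apply/measurable_EFinP; exact: continuous_measurable_fun.
under eq_integral do rewrite gee0_abs ?lee_fin ?y0//.
rewrite ge0_symfun_integralT//=.
  rewrite (_ : [set x | _] = `[0, +oo[%classic); last first.
    by apply/seteqP; split => x/=; rewrite in_itv/= andbT.
  by rewrite [X in (_ * X)%E]integral0y_oneDsqr -EFinM ltry.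
by move=> x /=; rewrite sqrrN.
Qed.

End dunkl_bounds.

(** * Expansion of the Poisson kernel *)

Section kernel_expansion.
Context {R : realType}.
Notation mu := (@lebesgue_measure R).
Variables (k t x : R).
Hypotheses (k_ge0 : 0 <= k) (t_gt0 : 0 < t).

Lemma is_cvg_series_abs_dunkl_h (s y : R) : 0 < s ->
  cvgn (series (fun n => expR (- s * eigenfreq k n) * `|dunkl_h k n x * dunkl_h k n y|)).
Proof.
move=> s0; have [C [M [C0 H]]] := dunkl_h_bound k_ge0.
apply: (@series_le_cvg _ _ (fun n => C ^+ 2 *
    (expR (- s * eigenfreq k n) * n.+1%:R ^+ (M + M)))).
- by move=> n; rewrite mulr_ge0 ?expR_ge0.
- by move=> n; rewrite mulr_ge0 ?sqr_ge0// mulr_ge0 ?expR_ge0 ?exprn_ge0.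
- move=> n; have [hx _] := H n x; have [hy _] := H n y.
  rewrite [leRHS]mulrCA ler_wpM2l ?expR_ge0// normrM.
  rewrite [leRHS](_ : _ = (C * n.+1%:R ^+ M) * (C * n.+1%:R ^+ M)).
    by rewrite ler_pM.
  by rewrite exprD expr2; ring.
- exact/is_cvg_seriesZ/is_cvg_series_expR_sqrt.
Qed.

Lemma is_cvg_series_abs_mehler (u y : R) : 0 < u ->
  cvgn (series (fun n => `|mehler_term k u x y n|)).
Proof.
move=> u0; have := @is_cvg_series_abs_dunkl_h u y u0.
apply: series_le_cvg => [n|n|n] //.
rewrite /mehler_term -mulrA normrM ger0_norm ?expR_ge0// ler_wpM2r//.
rewrite ler_expR !mulNr lerN2 ler_wpM2l ?(ltW u0)// -sqr_eigenfreq// expr2.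
by rewrite ler_peMl// ?(le_trans ler01)// eigenfreq_ge1.
Qed.

Lemma is_cvg_series_mehler (u y : R) : 0 < u ->
  cvgn (series (mehler_term k u x y)).
Proof. by move=> u0; apply: normed_cvg; exact: is_cvg_series_abs_mehler. Qed.

(** Termwise integration in [u]: the subordination formula turns the heat factor
    of each eigenfunction into its Poisson factor, and the sum of the integrals of
    the absolute values is the series of [is_cvg_series_abs_dunkl_h]. *)
Lemma poisson_kernel_series (y : R) :
  mu.-integrable `]0%R, +oo[ (fun u => (subordination_integrand k t x y u)%:E) /\
  series (fun n => expR (- t * eigenfreq k n) * (dunkl_h k n x * dunkl_h k n y)) @ \oo
    --> poisson_kernel k t x y.
Proof.
pose c := t / Num.sqrt (4 * pi).
have c0 : 0 < c by rewrite divr_gt0// sqrtr_gt0 mulr_gt0// pi_gt0.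
pose q n := dunkl_h k n x * dunkl_h k n y.
pose kap n (u : R) := subordinator t (eigenfreq k n) u.
have kap0 n u : 0 <= kap n u by exact: subordinator_ge0.
have ikap n : (\int[mu]_(u in `]0%R, +oo[) (kap n u)%:E =
    (expR (- t * eigenfreq k n))%:E)%E.
  by apply: integral_subordinator => //; rewrite (lt_le_trans ltr01)// eigenfreq_ge1.
have mkap n : measurable_fun (`]0%R, +oo[ : set R) (fun u => (kap n u)%:E).
  by apply/measurable_EFinP; exact: measurable_subordinator.
have int_kap n : mu.-integrable `]0%R, +oo[ (EFin \o kap n).
  apply/integrableP; split; first exact: mkap.
  by under eq_integral do rewrite /= ger0_norm//; rewrite ikap ltry.
pose g n (u : R) := q n * kap n u.
have g_abs n : (\int[mu]_(u in `]0%R, +oo[) (`|g n u|)%:E =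
    (expR (- t * eigenfreq k n) * `|q n|)%:E)%E.
  rewrite /g; under eq_integral do rewrite normrM EFinM (ger0_norm (kap0 n _)).
  rewrite ge0_integralZl//; first by rewrite [X in (_ * X)%E]ikap -EFinM mulrC.
    exact: mkap.
  by move=> u _; rewrite lee_fin.
have ig n : mu.-integrable `]0%R, +oo[ (EFin \o g n).
  by apply: eq_integrable (integrableZl _ (q n) (int_kap n)).
pose b (u : R) := c * (u `^ (- (3 / 2)) * expR (- (t ^+ 2 / (4 * u)))).
have gE n u : g n u = b u * mehler_term k u x y n.
  by rewrite /g /q /b /c /kap /subordinator sqr_eigenfreq// /mehler_term; ring.
have g_lim u : 0 < u ->
    series (g^~ u) @ \oo --> c * subordination_integrand k t x y u.
  move=> u0; rewrite (_ : series _ = fun N => b u * series (mehler_term k u x y) N).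
    rewrite [X in _ --> X](_ : _ = b u * mehler_kernel k u x y).
      by apply: cvgM; [exact: cvg_cst|exact: is_cvg_series_mehler].
    by rewrite /subordination_integrand /b; ring.
  apply/funext => N; rewrite /series/= mulr_sumr.
  by apply: eq_bigr => n _; exact: gE.
have cg (u : R) : `]0%R, +oo[%classic u -> cvgn (series (fun n => `|g n u|)).
  rewrite /= in_itv/= andbT => u0.
  rewrite (_ : (fun n => _) = `|b u| *: (fun n => `|mehler_term k u x y n|)).
    exact/is_cvg_seriesZ/is_cvg_series_abs_mehler.
  by apply/funext => n; rewrite gE normrM.
have [] := @integral_series _ _ R mu `]0%R, +oo[%classic (measurable_itv _) g
    (fun n => expR (- t * eigenfreq k n) * `|q n|) ig.
- by move=> n; rewrite g_abs.
- exact: is_cvg_series_abs_dunkl_h.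
- exact: cg.
move=> isub lim_int.
have limE : {in `]0%R, +oo[%classic, (fun u => limn (series (g^~ u))) =1
    (fun u => c * subordination_integrand k t x y u)}.
  by move=> u; rewrite inE/= in_itv/= andbT => /g_lim/cvg_lim; apply.
have icS : mu.-integrable `]0%R, +oo[ (fun u => (c * subordination_integrand k t x y u)%:E).
  by apply: eq_integrable isub => // u /limE /= ->.
have iS : mu.-integrable `]0%R, +oo[ (fun u => (subordination_integrand k t x y u)%:E).
  apply: (@eq_integrable _ _ _ mu _ _
    (fun u => (c^-1)%:E * (c * subordination_integrand k t x y u)%:E)%E) => //.
    by move=> u _; rewrite -EFinM mulrA mulVf ?mul1r// gt_eqF.
  exact: integrableZl.
split; first exact: iS.
have -> : poisson_kernel k t x y =
    \int[mu]_(u in `]0%R, +oo[) limn (series (g^~ u)).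
  by rewrite /poisson_kernel -RintegralZl//; exact/esym/eq_Rintegral.
rewrite (_ : (fun n => _) = (fun n => \int[mu]_(u in `]0%R, +oo[) g n u))//.
apply/funext => n; rewrite RintegralZl//.
by rewrite /Rintegral ikap mulrC.
Qed.

End kernel_expansion.

(** * The Poisson integral *)

(** This replaces Hoelder's inequality: a function in $L^p$ is a sum of an
    integrable function and a bounded one, and each $h_n$ is both bounded and
    integrable. *)
Lemma ler_1D_powR {R : realType} (z p : R) : 1 <= p -> 0 <= z -> z <= 1 + z `^ p.
Proof.
move=> p1 z0; have [z1|/ltW z1] := leP z 1.
  by rewrite (le_trans z1)// lerDl powR_ge0.
by rewrite (le_trans (le1r_powR z1 p1))// lerDr.
Qed.

(* limn and the real-valued integral are total, so the first five clauses say
   that the series and integrals occurring in the last one converge. *)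
Theorem proposition7 (R : realType) (k p : R) (f : R -> R)
    (hk : 0 <= k) (hp : 1 <= p) (hf : dunkl_Lp k p f)
    (t x : R) (ht : 0 < t) :
  (forall n : nat, lebesgue_measure.-integrable setT
     (fun s : R => (f s * dunkl_h k n s * dunkl_weight k s)%:E)) /\
  cvgn (series (poisson_term k f t x)) /\
  (forall u y : R, 0 < u -> cvgn (series (mehler_term k u x y))) /\
  (forall y : R, lebesgue_measure.-integrable `]0%R, +oo[
     (fun u : R => (subordination_integrand k t x y u)%:E)) /\
  lebesgue_measure.-integrable setT
     (fun y : R => (f y * poisson_kernel k t x y * dunkl_weight k y)%:E) /\
  poisson_integral k f t x =
    \int[lebesgue_measure]_y
      (f y * poisson_kernel k t x y * dunkl_weight k y).
Proof.
have [mf f_lty] := hf.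
pose mu := @lebesgue_measure R.
have [C [M [C0 hb]]] := dunkl_h_bound hk.
(* Up to a factor $C (n+1)^M$, [D] dominates the integrand of the [n]-th
   coefficient. *)
pose D (y : R) := `|f y| `^ p * dunkl_weight k y + (1 + y ^+ 2)^-1.
have D0 y : 0 <= D y.
  by rewrite addr_ge0 ?mulr_ge0 ?powR_ge0// invr_ge0 addr_ge0 ?sqr_ge0.
have iD : mu.-integrable setT (EFin \o D).
  rewrite [_ \o _](_ : _ = (fun y => (`|f y| `^ p * dunkl_weight k y)%:E) \+
      (fun y => ((1 + y ^+ 2)^-1)%:E))%E//.
  apply: integrableD => //; last exact: integrable_oneDsqrV.
  apply/integrableP; split.
    apply/measurable_EFinP; apply: measurable_funM; last exact: measurable_dunkl_weight.
    apply: (measurableT_comp (measurable_powR _)).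
    exact: measurableT_comp.
  by under eq_integral do rewrite gee0_abs ?lee_fin ?mulr_ge0 ?powR_ge0//.
pose h n (y : R) := f y * dunkl_h k n y * dunkl_weight k y.
have h_le n y : `|h n y| <= C * n.+1%:R ^+ M * D y.
  have [hn hw] := hb n y; have w0 := dunkl_weight_ge0 k y.
  rewrite /h (normrM _ (dunkl_weight k y)) (normrM (f y)) (ger0_norm w0).
  apply: (@le_trans _ _ ((1 + `|f y| `^ p) * `|dunkl_h k n y| * dunkl_weight k y)).
    by rewrite !ler_wpM2r// ler_1D_powR.
  rewrite mulrDl mul1r mulrDl addrC /D mulrDr lerD//.
  rewrite mulrAC [leRHS]mulrC; apply: ler_wpM2l => //.
  by rewrite mulr_ge0 ?powR_ge0.
have mh n : measurable_fun setT (h n).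
  apply: measurable_funM; last exact: measurable_dunkl_weight.
  by apply: measurable_funM => //; exact: measurable_dunkl_h.
have B0 n : 0 <= C * n.+1%:R ^+ M by rewrite mulr_ge0 ?exprn_ge0.
have ih n : mu.-integrable setT (EFin \o h n).
  apply: (@le_integrable _ _ _ mu _ _ _ (fun y => (C * n.+1%:R ^+ M)%:E * (D y)%:E)%E) => //.
  - apply/measurable_EFinP; exact: mh.
  - move=> y _; rewrite -EFinM lee_fin (le_trans (h_le n y))//.
    exact: ler_norm.
  - exact: integrableZl.
have int_h n : (\int[mu]_y (`|h n y|)%:E <=
    (C * n.+1%:R ^+ M * fine (\int[mu]_y (D y)%:E))%:E)%E.
  rewrite EFinM fineK; last exact: integrable_fin_num.
  rewrite -integralZl//; apply: ge0_le_integral => //.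
  - by apply/measurable_EFinP; apply: (measurableT_comp _ (mh n)).
  - by have /integrableP[] := integrableZl measurableT (C * n.+1%:R ^+ M) iD.
  - by move=> y _; rewrite -EFinM lee_fin.
(* Termwise integration in [y] of $f(y) A_k(t,x,y) |y|^{2k}$, with the kernel
   expanded by [poisson_kernel_series]. *)
pose e n := expR (- t * eigenfreq k n) * dunkl_h k n x.
pose g n (y : R) := e n * h n y.
pose I := fine (\int[mu]_y (D y)%:E).
have I0 : 0 <= I by rewrite fine_ge0// integral_ge0// => y _; rewrite lee_fin.
pose B n := C ^+ 2 * I * (expR (- t * eigenfreq k n) * n.+1%:R ^+ (M + M)).
have e_le n : `|e n| <= expR (- t * eigenfreq k n) * (C * n.+1%:R ^+ M).
  by rewrite normrM ger0_norm ?expR_ge0// ler_wpM2l ?expR_ge0//; case: (hb n x).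
have BE n : B n = expR (- t * eigenfreq k n) * (C * n.+1%:R ^+ M) * (C * n.+1%:R ^+ M * I).
  by rewrite /B exprD; ring.
have ig n : mu.-integrable setT (EFin \o g n).
  by apply: eq_integrable (integrableZl _ (e n) (ih n)).
have gB n : (\int[mu]_y (`|g n y|)%:E <= (B n)%:E)%E.
  under eq_integral do rewrite normrM EFinM.
  rewrite ge0_integralZl//; last first.
    by apply/measurable_EFinP; apply: (measurableT_comp _ (mh n)).
  rewrite BE [leRHS]EFinM; apply: lee_pmul; last exact: int_h.
  - by [].
  - by rewrite integral_ge0.
  - by rewrite lee_fin.
have cB : cvgn (series B) by exact/is_cvg_seriesZ/is_cvg_series_expR_sqrt.
have gE y : g^~ y = (f y * dunkl_weight k y) *:
    (fun n => expR (- t * eigenfreq k n) * (dunkl_h k n x * dunkl_h k n y)).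
  apply/funext => n; rewrite /g /e /h.
  transitivity ((f y * dunkl_weight k y) *
    (expR (- t * eigenfreq k n) * (dunkl_h k n x * dunkl_h k n y))); first by ring.
  by [].
have cg y : cvgn (series (fun n => `|g n y|)).
  rewrite (_ : (fun n => _) = `|f y * dunkl_weight k y| *: (fun n =>
      expR (- t * eigenfreq k n) * `|dunkl_h k n x * dunkl_h k n y|)).
    exact/is_cvg_seriesZ/is_cvg_series_abs_dunkl_h.
  apply/funext => n; have /(congr1 (fun a => a n)) -> := gE y.
  by rewrite /= normrM [X in _ * X]normrM (ger0_norm (expR_ge0 _)).
have limE y : limn (series (g^~ y)) = f y * poisson_kernel k t x y * dunkl_weight k y.
  have [_ lim_y] := poisson_kernel_series x hk ht y.
  rewrite gE lim_seriesZ; last by apply/cvg_ex; exists (poisson_kernel k t x y).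
  by rewrite (cvg_lim _ lim_y)// mulrAC.
have [] := @integral_series _ _ R mu setT measurableT g B ig gB cB (fun y _ => cg y).
move=> ilim lim_int.
have termE : (fun n => \int[mu]_y g n y) = poisson_term k f t x.
  apply/funext => n; rewrite RintegralZl//.
  by rewrite /poisson_term /dunkl_coef /e mulrAC.
rewrite termE in lim_int.
have limfE : (fun y => limn (series (g^~ y))) =
    (fun y => f y * poisson_kernel k t x y * dunkl_weight k y).
  by apply/funext.
split; first exact: ih.
split; first by apply/cvg_ex; eexists; exact: lim_int.
split; first by move=> u y u0; exact: is_cvg_series_mehler.
split; first by move=> y; have [] := poisson_kernel_series x hk ht y.
split.
  apply: eq_integrable ilim => // y _; rewrite limE//.
by rewrite /poisson_integral (cvg_lim _ lim_int)// limfE.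
Qed.
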